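(* Let $\psi\in\mathbb{Q}\setminus\{0,1\}$ and let $X_{\psi}\subset\mathbb{P}^3$ be the quartic surface $$x_0^3x_1+x_1^3x_2+x_2^3x_3+x_3^4-27\psi\,x_0x_1x_2x_3=0.$$ Put $t=2^{-6}3^{-24}5^{-5}7^{-7}\psi^{-27}$ and $$\bm{\alpha}=\left\{\tfrac{k}{27}:1\le k\le 26,\ 3\nmid k\right\},\qquad \bm{\beta}=\left\{\tfrac13,\tfrac23,\tfrac12,\tfrac15,\tfrac25,\tfrac35,\tfrac45,\tfrac16,\tfrac56,\tfrac17,\tfrac27,\tfrac37,\tfrac47,\tfrac57,\tfrac67,1,1,1\right\}.$$ Let $S$ be the set consisting of the primes $2,3,5,7$ together with all primes dividing the numerator or the denominator of $t$ or of $t-1$. Then $$L_S(X_{\psi},s)=\zeta_{S,\mathbb{Q}(i\sqrt{3})}(s-1)\,\zeta_S(s-1)\,L_S\big(H(\bm{\alpha},\bm{\beta}\mid t),s\big).$$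
   Context: Gauss sums: for a power $q=p^u$ of an odd prime $p$, write $q^\times=q-1$, fix a generator $\omega$ of the cyclic group of multiplicative characters $\mathbb{F}_q^\times\to\mathbb{C}^\times$ and a nontrivial additive character $\Theta$ of $\mathbb{F}_q$, and set $g(m)=\sum_{x\in\mathbb{F}_q^\times}\omega^m(x)\Theta(x)$ for $m\in\mathbb{Z}$. Finite field hypergeometric sums: for multisets $\bm{\alpha}=\{\alpha_1,\dots,\alpha_d\}$, $\bm{\beta}=\{\beta_1,\dots,\beta_d\}$ of rationals with $\alpha_i-\beta_j\notin\mathbb{Z}$ for all $i,j$, put $F(x)=\prod_i(x-e^{2\pi i\alpha_i})$, $G(x)=\prod_i(x-e^{2\pi i\beta_i})$. The pair is defined over $\mathbb{Q}$ if $F,G\in\mathbb{Q}[x]$; then $F/G=\prod_{j=1}^r(x^{p_j}-1)/\prod_{j=1}^s(x^{q_j}-1)$ with positive integers $p_j,q_j$ and $\{p_j\}\cap\{q_j\}=\emptyset$. The prime power $q$ is good for the pair if $\gcd(q,\mathrm{lcd}(\bm{\alpha}\cup\bm{\beta}))=1$. Then let $D(x)=\gcd\big(\prod_j(x^{p_j}-1),\prod_j(x^{q_j}-1)\big)$, $\epsilon=(-1)^{\sum_j q_j}$, $M=\prod_j p_j^{p_j}\prod_j q_j^{-q_j}$, and for $m\in\mathbb{Z}/q^\times\mathbb{Z}$ let $s(m)$ be the multiplicity of $e^{2\pi i m/q^\times}$ as a root of $D$. For $t\in\mathbb{F}_q^\times$, $$H_q(\bm{\alpha},\bm{\beta}\mid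 t)=\frac{(-1)^{r+s}}{1-q}\sum_{m=0}^{q-2}q^{-s(0)+s(m)}\prod_{i=1}^r g(p_im)\prod_{i=1}^s g(-q_im)\,\omega(\epsilon M^{-1}t)^m.$$ $L$-functions: for $p\notin S$, let $Z_p(X_\psi,T)=\exp\big(\sum_{m\ge1}\#X_\psi(\mathbb{F}_{p^m})T^m/m\big)$ and define $P_p(T)$ by $Z_p(X_\psi,T)=1/\big((1-T)(1-pT)(1-p^2T)P_p(T)\big)$; then $L_S(X_\psi,s)=\prod_{p\notin S}P_p(p^{-s})^{-1}$. For a pair defined over $\mathbb{Q}$ and $t\in\mathbb{Q}$, $L_p(H(\bm{\alpha},\bm{\beta}\mid t),T)=\exp\big(-\sum_{r\ge1}H_{p^r}(\bm{\alpha},\bm{\beta}\mid t)T^r/r\big)$ (with $t$ reduced mod $p$) and $L_S(H(\bm{\alpha},\bm{\beta}\mid t),s)=\prod_{p\notin S}L_p(H(\bm{\alpha},\bm{\beta}\mid t),p^{-s})^{-1}$. Also $\zeta_S(s)=\prod_{p\notin S}(1-p^{-s})^{-1}$ and, for a number field $K$, $\zeta_{S,K}(s)=\prod_{\mathfrak{p}}(1-\mathrm{N}\mathfrak{p}^{-s})^{-1}$ over primes $\mathfrak{p}$ of $K$ not lying above primes in $S$. *)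

(* Defs.v *)
From HB Require Import structures.
From mathcomp Require Import all_boot all_order all_algebra all_field.
From mathcomp Require Import finmap complex.
From mathcomp Require Import all_classical all_reals all_analysis.

Set Implicit Arguments.
Unset Strict Implicit.
Unset Printing Implicit Defensive.

Import Order.TTheory GRing.Theory Num.Theory numFieldNormedType.Exports.

Local Open Scope classical_set_scope.
Local Open Scope ring_scope.

(* R[i] seen as a numClosedFieldType: the topology of MathComp-Analysis on
   an abstract numFieldType is found on this alias, and not on R[i] itself. *)
Definition Cplx (R : realType) : numClosedFieldType := R[i]%C.

Section Complex.
Variable R : realType.
Local Notation C := (Cplx R).

Definition cpolar (r theta : R) : C := Complex (r * cos theta) (r * sin theta).

(* e^{2 pi i a} *)
Definition expi2pi (a : rat) : C := cpolar 1 (2 * pi * ratr a).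

(* n^s = e^{s log n}, for n > 0 *)
Definition natpow (n : nat) (s : C) : C :=
  cpolar (expR (complex.Re s * ln n%:R)) (complex.Im s * ln n%:R).

End Complex.

(* A formal power series sum_n a_n T^n is its sequence of coefficients a.
   A coefficient of index n depends only on the series modulo T^(n+1), so it
   is computed with polynomials truncated at that order. *)
Section FormalSeries.
Variable F : fieldType.

Definition fps_trunc (a : nat -> F) (n : nat) : {poly F} := \poly_(i < n.+1) a i.

Definition fps_mul (a b : nat -> F) (n : nat) : F :=
  (fps_trunc a n * fps_trunc b n)`_n.

(* exp(a) = sum_k a^k / k!, for a_0 = 0 *)
Definition fps_exp (a : nat -> F) (n : nat) : F :=
  (\sum_(k < n.+1) (k`!%:R)^-1 *: fps_trunc a n ^+ k)`_n.

(* 1/a = sum_k (1 - a)^k, for a_0 = 1 *)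
Definition fps_inv (a : nat -> F) (n : nat) : F :=
  (\sum_(k < n.+1) (1 - fps_trunc a n) ^+ k)`_n.

End FormalSeries.

(* The infinite product is given by its sequence of partial products; it
   converges when these have a nonzero limit. *)
Definition prod_converges (R : realType) (u : nat -> Cplx R) : Prop :=
  cvgn u /\ limn u != 0.

Section EulerProducts.
Variable R : realType.
Local Notation C := (Cplx R).
Variable S : pred nat.

(* P : p |-> formal power series P_p(T); the Euler product is
   prod_(p notin S) P_p(p^{-s})^{-1}. *)
Definition local_value (P : nat -> nat -> C) (s : C) (p : nat) : C :=
  limn (series (fun n => P p n * natpow p (- s) ^+ n)).

Definition euler_partial (P : nat -> nat -> C) (s : C) (N : nat) : C :=
  \prod_(p < N.+1 | prime p && ~~ S p) (local_value P s p)^-1.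

Definition euler_product (P : nat -> nat -> C) (s : C) : C :=
  limn (euler_partial P s).

Definition euler_converges (P : nat -> nat -> C) (s : C) : Prop :=
  (forall p, prime p -> ~~ S p ->
     cvgn (series (fun n => P p n * natpow p (- s) ^+ n)))
  /\ prod_converges (euler_partial P s).

Definition zeta_partial (s : C) (N : nat) : C :=
  \prod_(p < N.+1 | prime p && ~~ S p) (1 - natpow p (- s))^-1.

Definition zeta (s : C) : C := limn (zeta_partial s).

End EulerProducts.

Section DedekindZeta.
Variable K : fieldExtType rat.

Definition ring_of_integers : set K := [set x | integralOver (intr : int -> K) x].

Local Notation OK := ring_of_integers.

(* Zero is excluded, as usual for the primes of a number field. *)
Definition nonzero_prime_ideal (P : set K) : Prop :=
  [/\ P `<=` OK /\ P 0,
      (forall x y, P x -> P y -> P (x + y)),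
      (forall a x, OK a -> P x -> P (a * x)),
      (~ P 1 /\ forall x y, OK x -> OK y -> P (x * y) -> P x \/ P y)
    & exists2 x, P x & x != 0].

Definition residue_ring (P : set K) : set (set K) :=
  [set [set x + y | y in P] | x in OK].

Definition ideal_norm (P : set K) : nat := #|` fset_set (residue_ring P)|.

Variable S : pred nat.

Definition above_S (P : set K) : Prop :=
  exists p, [/\ prime p, S p & P p%:R].

Definition primes_upto (N : nat) : set (set K) :=
  [set P | [/\ nonzero_prime_ideal P, ~ above_S P & (ideal_norm P <= N)%N]].

Variable R : realType.

Definition dedekind_partial (s : Cplx R) (N : nat) : Cplx R :=
  \big[*%R/1]_(P \in primes_upto N) (1 - natpow (ideal_norm P) (- s))^-1.

Definition dedekind_zeta (s : Cplx R) : Cplx R := limn (dedekind_partial s).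

End DedekindZeta.

(* Functions on K^* are represented by functions on K, whose value at 0 is
   irrelevant. *)
Section FiniteFieldHypergeometric.
Variable R : realType.
Local Notation C := (Cplx R).

Section Characters.
Variable K : finFieldType.

Definition mult_character (chi : K -> C) : Prop :=
  (forall x, x != 0 -> chi x != 0)
  /\ forall x y, x != 0 -> y != 0 -> chi (x * y) = chi x * chi y.

Definition generates_mult_characters (omega : K -> C) : Prop :=
  mult_character omega
  /\ forall chi, mult_character chi ->
       exists k : int, forall x, x != 0 -> chi x = omega x ^ k.

Definition nontrivial_add_character (Theta : K -> C) : Prop :=
  [/\ forall x, Theta x != 0,
      forall x y, Theta (x + y) = Theta x * Theta y
    & exists x, Theta x != 1].

Definition gauss_sum (omega Theta : K -> C) (m : int) : C :=
  \sum_(x : K | x != 0) omega x ^ m * Theta x.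

End Characters.

Definition param_poly (al : seq rat) : {poly C} :=
  \prod_(a <- al) ('X - (expi2pi R a)%:P).

Definition cyc_poly (ps : seq nat) : {poly C} := \prod_(p <- ps) ('X^p - 1).

(* F/G = prod_j (x^{p_j} - 1) / prod_j (x^{q_j} - 1) *)
Definition cyc_exponents (al be : seq rat) (pq : seq nat * seq nat) : Prop :=
  [/\ all (leq 1) pq.1, all (leq 1) pq.2, ~~ has (mem pq.1) pq.2
    & param_poly al * cyc_poly pq.2 = param_poly be * cyc_poly pq.1].

(* The p_j and q_j of a pair defined over Q, unique up to order *)
Definition exponents_of (al be : seq rat) : seq nat * seq nat :=
  xget ([::], [::]) [set pq | cyc_exponents al be pq].

Definition hgm_M (ps qs : seq nat) : rat :=
  (\prod_(p <- ps) (p%:R : rat) ^+ p) / \prod_(q <- qs) (q%:R : rat) ^+ q.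

(* s(m): the gcd D, taken over C, is determined up to a nonzero scalar. *)
Definition root_mult (ps qs : seq nat) (q m : nat) : nat :=
  mup (expi2pi R (m%:R / q.-1%:R)) (gcdp (cyc_poly ps) (cyc_poly qs)).

(* H_q(al, be | t), for q = #|K| *)
Definition hypergeom_sum (K : finFieldType) (omega Theta : K -> C)
    (al be : seq rat) (t : K) : C :=
  let: (ps, qs) := exponents_of al be in
  let q := #|K| in
  let g := gauss_sum omega Theta in
  let s := root_mult ps qs q in
  let eps : K := (-1) ^+ sumn qs in
  (-1) ^+ (size ps + size qs) / (1 - q%:R) *
  \sum_(0 <= m < q.-1)
     (q%:R : C) ^ ((s m)%:Z - (s 0%N)%:Z)
     * (\prod_(p <- ps) g (p * m)%N%:Z) * (\prod_(r <- qs) g (- (r * m)%N%:Z))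
     * omega (eps * (ratr (hgm_M ps qs))^-1 * t) ^+ m.

End FiniteFieldHypergeometric.

(* Below, fld p m is a field with p^m elements (p prime,
   m > 0). A rational number is reduced modulo p by ratr, which is meaningful
   when p does not divide its denominator. *)

Section HypergeometricLFunction.
Variables (R : realType) (fld : nat -> nat -> finFieldType).
Variables omega Theta : forall p m, fld p m -> Cplx R.

(* L_p(H(al, be | t), T) *)
Definition hgm_Lp (al be : seq rat) (t : rat) (p : nat) : nat -> Cplx R :=
  fps_exp (fun r => if r == 0%N then 0 else
    - (hypergeom_sum (@omega p r) (@Theta p r) al be (ratr t) / r%:R)).

End HypergeometricLFunction.

Section Surface.
Variables (R : realType) (fld : nat -> nat -> finFieldType).

Definition quartic (K : fieldType) (psi : K) (x : 'rV[K]_4) : K :=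
  let x0 := x 0 (inord 0) in let x1 := x 0 (inord 1) in
  let x2 := x 0 (inord 2) in let x3 := x 0 (inord 3) in
  x0 ^+ 3 * x1 + x1 ^+ 3 * x2 + x2 ^+ 3 * x3 + x3 ^+ 4
  - 27%:R * psi * x0 * x1 * x2 * x3.

(* A point of P^3(K) is the set of its homogeneous coordinate vectors. *)
Definition surface_points (K : finFieldType) (psi : K) : {set {set 'rV[K]_4}} :=
  [set ([set c *: x | c : K & c != 0]%SET : {set 'rV[K]_4})
     | x : 'rV[K]_4 & (x != 0) && (quartic psi x == 0)]%SET.

(* Z_p(X_psi, T) *)
Definition surface_zeta (psi : rat) (p : nat) : nat -> Cplx R :=
  fps_exp (fun m => if m == 0%N then 0 else
    #|surface_points (ratr psi : fld p m)|%:R / m%:R).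

(* P_p(T), where Z_p = 1 / ((1 - T) (1 - p T) (1 - p^2 T) P_p) *)
Definition surface_Pp (psi : rat) (p : nat) : nat -> Cplx R :=
  let D : {poly Cplx R} :=
    (1 - 'X) * (1 - p%:R *: 'X) * (1 - (p ^ 2)%:R *: 'X) in
  fps_inv (fps_mul (fun n => D`_n) (surface_zeta psi p)).

End Surface.

Definition t_of (psi : rat) : rat :=
  (2 ^+ 6 * 3 ^+ 24 * 5 ^+ 5 * 7 ^+ 7 * psi ^+ 27)^-1.

Definition hgm_alpha : seq rat := [seq k%:R / 27%:R | k <- iota 1 26 & ~~ (3 %| k)%N].

Definition hgm_beta : seq rat :=
  [:: 1/3; 2/3; 1/2; 1/5; 2/5; 3/5; 4/5; 1/6; 5/6;
      1/7; 2/7; 3/7; 4/7; 5/7; 6/7; 1; 1; 1].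

Definition bad_prime (t : rat) : pred nat := fun p =>
  prime p &&
  [|| p \in [:: 2; 3; 5; 7],
      (p %| `|numq t|)%N, (p %| `|denq t|)%N,
      (p %| `|numq (t - 1)|)%N | (p %| `|denq (t - 1)|)%N].

(* Main.v *)
Require Import Defs.
From HB Require Import structures.
From mathcomp Require Import all_boot all_order all_algebra all_field.
From mathcomp Require Import finmap complex.
From mathcomp Require Import all_classical all_reals all_analysis.
From mathcomp Require Import cyclic ring lra zify.

Set Implicit Arguments.
Unset Strict Implicit.
Unset Printing Implicit Defensive.

Import Order.TTheory GRing.Theory Num.Theory numFieldNormedType.Exports.

Import Normc.

Local Open Scope ring_scope.

(** Counting the points of [X_psi] by the coordinates that vanish leaves two
    torus counts: the open part and the curve [y^3 z + z^3 + 1 = 0].  Both are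
    exponential sums, and since the lattice of relations between the five
    monomials of the quartic is generated by [27 u = 9 e0 + 6 e1 + 7 e2 + 5 e3],
    expanding the sum over [m] in [H_q] by orthogonality of characters gives
    back exactly these two sums: the factor [q^(s m - s 0)] equals
    [(1 + sum_t omega(t)^(9 m)) / q], where [1] yields the open part and the
    sum over [t] the curve.  Hence
      [#X_psi(F_q) = 1 + q + q^2 + q * #{z^3 = 1} + H_q],
    and [#{z^3 = 1} = 2 + chi(q)] with [chi] the quadratic character of
    Q(sqrt(-3)).  This is the identity of Euler factors; the Euler products
    are then compared using absolute convergence, the prime ideals of Q(sqrt(-3))
    prime to 6 being the kernels of the reductions [theta |-> a], [a^2 = -3]. *)

(** * Complex limits and infinite products *)

(** The constants in H_q are such that epsilon M^-1 t = c^-27 with c = -27 psi. Orthogonality then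
    imposes on five free variables the relation v^27 = c^27 z0^9 z1^6 z2^7 z3^5. As 27, 9, 6, 7, 5
    have no common factor, its solutions are parametrised by monomials, which gives the open part.
    The extra factor t^9 allows a ninth root to be extracted, because the exponents 27 and 9 of v
    and z0 are multiples of 9; v and z0 become free and the curve remains. The p_j, q_j are
    determined only up to order, so their uniqueness has to be established before H_q can be
    computed. Euler factors are compared through T d/dT log, where a product becomes a sum of
    coefficients indexed by the fields F_{p^n}; the term (chi(p) p)^n accounts for the factor 1 -
    chi(p) p T. A partial product of the Dedekind zeta function is cut by norm, so an inert p enters
    only when p^2 <= N, whereas the other Euler products admit it when p <= N. The partial products
    differ; split and inert parts are treated as separately convergent products so that the limits
    can be identified. *)

Section ComplexLimits.
Variable R : realType.
Local Notation C := (Cplx R).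
Implicit Types (u x : nat -> C) (M v : nat -> R) (z w s : C).

(** The norm of the field [Cplx R] has its values in [Cplx R] itself; estimates are made with the
    real modulus [normc] and transferred by this equation. *)
Lemma normcplxE z : `|z| = ((normc z)%:C)%C :> C.
Proof. by case: z. Qed.

Lemma normc_cplx_ge0 z : 0 <= normc z.
Proof. by case: z => a b /=; exact: sqrtr_ge0. Qed.

Lemma normc_cplxM z w : normc (z * w : C) = normc z * normc w.
Proof. exact: normcM. Qed.

Lemma normc_cplxD z w : normc (z + w : C) <= normc z + normc w.
Proof. exact: le_normcD. Qed.

Lemma normc_cplxN z : normc (- z : C) = normc z.
Proof. exact: normcN. Qed.

Lemma normc_cplx1 : normc (1 : C) = 1.
Proof. exact: normc1. Qed.

Lemma normc_cplx0 : normc (0 : C) = 0.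
Proof. exact: normc0. Qed.

Lemma normc_cplxV z : normc (z^-1 : C) = (normc z)^-1.
Proof. exact: normcV. Qed.

Lemma normc_cplxX z n : normc (z ^+ n : C) = normc z ^+ n.
Proof.
elim: n => [|n IHn]; first by rewrite !expr0 normc_cplx1.
by rewrite !exprS normc_cplxM IHn.
Qed.

Lemma normc_cplx_nat n : normc (n%:R : C) = n%:R.
Proof.
have /complexI : ((normc (n%:R : C))%:C)%C = ((n%:R : R)%:C)%C; last by [].
by rewrite -normcplxE normr_nat rmorph_nat.
Qed.

Lemma normc_cplx_sum (I : Type) (r : seq I) (P : pred I) (F : I -> C) :
  normc (\sum_(i <- r | P i) F i : C) <= \sum_(i <- r | P i) normc (F i).
Proof.
elim/big_ind2 : _ => [||//]; first by rewrite normc_cplx0.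
by move=> a b c d ab cd; rewrite (le_trans (normc_cplxD _ _))// lerD.
Qed.

Lemma normc_ge_norm_Re z : `|complex.Re z| <= normc z.
Proof. by case: z => a b /=; rewrite -sqrtr_sqr ler_wsqrtr // lerDl sqr_ge0. Qed.

Lemma normc_ge_norm_Im z : `|complex.Im z| <= normc z.
Proof. by case: z => a b /=; rewrite -sqrtr_sqr ler_wsqrtr // lerDr sqr_ge0. Qed.

Lemma normc_le_ReDIm z : normc z <= `|complex.Re z| + `|complex.Im z|.
Proof.
case: z => a b /=; rewrite -(ler_pXn2r (n := 2)) ?nnegrE ?sqrtr_ge0 ?addr_ge0 //.
rewrite sqr_sqrtr ?addr_ge0 ?sqr_ge0 // sqrrD !real_normK ?num_real //.
by rewrite lerD2r lerDl mulrn_wge0 // mulr_ge0.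
Qed.

Lemma cvg_cplx u (l : C) :
  (complex.Re (u n) @[n --> \oo] --> complex.Re l)%classic ->
  (complex.Im (u n) @[n --> \oo] --> complex.Im l)%classic ->
  (u n @[n --> \oo] --> l)%classic.
Proof.
move=> ure uim; apply/cvgrPdist_lt => e e0.
(* The radius [e] lives in [Cplx R]; positivity for the complex order makes it a positive real. *)
have [ei er] : complex.Im e = 0 /\ 0 < complex.Re e.
  have : (0 < e) = (complex.Im e == 0) && (0 < complex.Re e) by exact: (@ltcE R 0 e).
  by rewrite e0 => /esym/andP[/eqP].
have eE : e = ((complex.Re e)%:C)%C by case: e ei {e0 er} => a b /= ->.
have e2 : 0 < complex.Re e / 2 by rewrite divr_gt0.
move/cvgrPdist_lt : ure => /(_ _ e2) ure; move/cvgrPdist_lt : uim => /(_ _ e2) uim.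
near=> n; rewrite normcplxE eE.
have -> : ((normc (l - u n : C))%:C < ((complex.Re e)%:C))%C = (normc (l - u n : C) < complex.Re e).
  exact: ltcR.
apply: (le_lt_trans (normc_le_ReDIm _)).
have hre : complex.Re (l - u n) = complex.Re l - complex.Re (u n) by case: (l) (u n) => ? ? [].
have him : complex.Im (l - u n) = complex.Im l - complex.Im (u n) by case: (l) (u n) => ? ? [].
rewrite hre him [ltRHS]splitr ltrD //; near: n; [exact: ure|exact: uim].
Unshelve. all: by end_near.
Qed.

Lemma Re_series u n : complex.Re (series u n) = series (fun k => complex.Re (u k)) n.
Proof. by rewrite /series /= (big_morph (@complex.Re R) (id1 := 0) (op1 := +%R)) // => -[? ?] []. Qed.

Lemma Im_series u n : complex.Im (series u n) = series (fun k => complex.Im (u k)) n.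
Proof. by rewrite /series /= (big_morph (@complex.Im R) (id1 := 0) (op1 := +%R)) // => -[? ?] []. Qed.

(** Real and imaginary parts are dominated by the modulus, so the real comparison test applies to
    each. *)
Lemma cplx_series_cvg u v :
  (forall n, normc (u n) <= v n) -> cvgn (series v) -> cvgn (series u).
Proof.
move=> uv cv.
have v0 n : 0 <= v n by rewrite (le_trans _ (uv n)) // normc_cplx_ge0.
have real_cvg (f : nat -> R) : (forall n, `|f n| <= v n) -> cvgn (series f).
  by move=> fv; apply: normed_cvg; apply: series_le_cvg cv => //= n; exact: fv.
have /cvg_ex[a ha] := real_cvg (fun n => complex.Re (u n)) (fun n => le_trans (normc_ge_norm_Re _) (uv n)).
have /cvg_ex[b hb] := real_cvg (fun n => complex.Im (u n)) (fun n => le_trans (normc_ge_norm_Im _) (uv n)).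
apply/cvg_ex; exists (Complex a b : C); apply: cvg_cplx => /=.
  by under eq_fun do rewrite Re_series.
by under eq_fun do rewrite Im_series.
Qed.

(** The partial products P_N are bounded by B = exp(sum M), and P_N = 1 + sum_{n<N} P_n x_n by
    telescoping; this series is dominated by B M_n. *)
Lemma prod_cvg x M :
  (forall n, normc (x n) <= M n) -> cvgn (series M) ->
  cvgn (fun N => \prod_(n < N) (1 + x n)).
Proof.
move=> xM cM; set P : nat -> C := fun N => _.
have M0 n : 0 <= M n by rewrite (le_trans _ (xM n)) // normc_cplx_ge0.
have PS N : P N.+1 = P N * (1 + x N) by rewrite /P big_ord_recr.
have Pb N : normc (P N) <= expR (series M N).
  elim: N => [|N IHN]; first by rewrite /P /series /= big_ord0 big_geq // expR0 normc_cplx1.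
  rewrite PS normc_cplxM seriesSr expRD ler_pM ?normc_cplx_ge0 //.
  rewrite (le_trans (normc_cplxD _ _)) // normc_cplx1.
  by rewrite (le_trans _ (expR_ge1Dx _)) // lerD2l.
have ndM : nondecreasing_seq (series M).
  by apply/nondecreasing_seqP => n; rewrite seriesSr lerDl.
set B := expR (limn (series M)).
have PB N : normc (P N) <= B by rewrite (le_trans (Pb N)) // ler_expR nondecreasing_cvgn_le.
have -> : P = (fun N => 1 + series (fun n => P n * x n) N).
  apply/funext; elim=> [|N IHN]; first by rewrite /P /series /= big_ord0 big_geq // addr0.
  by rewrite PS mulrDr mulr1 {1}IHN seriesSr addrA.
apply: is_cvgD; first exact: is_cvg_cst.
apply: (cplx_series_cvg (v := fun n => B * M n)).
  by move=> n; rewrite normc_cplxM ler_pM // normc_cplx_ge0.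
exact: is_cvg_seriesZ.
Qed.

(* The limit is nonzero because the products of the inverses converge as well. *)
Lemma prod_converges_of_inv (f : nat -> C) M :
  (forall n, f n != 0) -> (forall n, normc (f n - 1) <= M n) ->
  (forall n, normc ((f n)^-1 - 1) <= M n) -> cvgn (series M) ->
  prod_converges (fun N => \prod_(n < N.+1) f n).
Proof.
move=> f0 fM fVM cM.
have := @prod_cvg (fun n => f n - 1) M fM cM.
under eq_fun do under eq_bigr do rewrite addrC subrK.
have := @prod_cvg (fun n => (f n)^-1 - 1) M fVM cM.
under eq_fun do under eq_bigr do rewrite addrC subrK.
set h' := (fun N => _); set h := (fun N => _) => ch' ch.
have ch1 : (h n.+1 @[n --> \oo] --> limn h)%classic.
  by rewrite (cvg_shiftS h).
split; first by apply/cvg_ex; exists (limn h).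
rewrite (cvg_lim _ ch1) //; apply/negP => /eqP l0.
have hh' n : h n * h' n = 1.
  by rewrite /h /h' -big_split /= big1 // => i _; rewrite divff.
clearbody h h'; have := cvgM ch ch'.
have -> : h \* h' = (fun=> 1) by apply/funext => n; rewrite /= hh'.
rewrite l0 mul0r => h1; have : limn (fun=> 1 : C) = 0 by apply: cvg_lim; [exact: norm_hausdorff|exact: h1].
by rewrite lim_cst // => /eqP; rewrite oner_eq0.
Qed.

(** The bound 1/2 on a_p gives |1 - a_p| >= 1/2, so both (1 - a_p)^-1 and its inverse differ from 1
    by at most 2 M_p. *)
Lemma prod_converges_euler (P : pred nat) (a : nat -> C) M :
  (forall n, 0 <= M n) -> (forall n, P n -> normc (a n) <= M n) ->
  (forall n, P n -> normc (a n) <= 2^-1) -> cvgn (series M) ->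
  prod_converges (fun N => \prod_(p < N.+1 | P p) (1 - a p)^-1).
Proof.
move=> M0 aM a2 cM.
pose f p : C := if P p then (1 - a p)^-1 else 1.
have lb n : P n -> 2^-1 <= normc (1 - a n).
  move=> Pn; have := normc_cplxD (1 - a n) (a n).
  rewrite subrK normc_cplx1; have := a2 _ Pn; lra.
have nz n : P n -> 1 - a n != 0.
  by move=> Pn; apply/eqP => h; have := lb _ Pn; rewrite h normc_cplx0; lra.
have -> : (fun N => \prod_(p < N.+1 | P p) (1 - a p)^-1) = (fun N => \prod_(p < N.+1) f p).
  by apply/funext => N; rewrite big_mkcond.
apply: (@prod_converges_of_inv f (fun n => 2 * M n)) => [n|n|n|];
  rewrite /f; last exact: is_cvg_seriesZ.
- by case: ifPn => [/nz|_]; rewrite ?invr_eq0 // oner_eq0.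
- case: ifPn => [Pn|_]; last by rewrite subrr normc_cplx0 mulr_ge0.
  have -> : (1 - a n)^-1 - 1 = a n / (1 - a n) by field; apply: nz.
  rewrite normc_cplxM normc_cplxV mulrC ler_pM ?invr_ge0 ?normc_cplx_ge0 ?aM //.
  by rewrite -[leRHS]invrK lef_pV2 ?lb // posrE ?invr_gt0 //; have := lb _ Pn; lra.
- case: ifPn => [Pn|_]; last by rewrite invr1 subrr normc_cplx0 mulr_ge0.
  rewrite invrK addrC addKr normc_cplxN (le_trans (aM _ Pn)) //.
  by have := M0 n; lra.
Qed.

Lemma cpolarM r r' t t' : cpolar r t * cpolar r' t' = cpolar (r * r') (t + t') :> C.
Proof.
apply/eqP; rewrite eq_complex /= cosD sinD.
by apply/andP; split; apply/eqP; ring.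
Qed.

Lemma normc_cpolar r t : 0 <= r -> normc (cpolar r t : C) = r.
Proof.
move=> r0; rewrite /= !exprMn -mulrDr cos2Dsin2 mulr1 sqrtr_sqr.
by rewrite ger0_norm.
Qed.

Lemma normc_natpow n s : normc (natpow n s) = expR (complex.Re s * ln n%:R).
Proof. by rewrite normc_cpolar // expR_ge0. Qed.

Lemma natpowD n s z : natpow n (s + z) = natpow n s * natpow n z.
Proof.
rewrite /natpow cpolarM -expRD; case: s z => a b [c d] /=.
by rewrite -!mulrDl.
Qed.

Lemma natpow1 n : (0 < n)%N -> natpow n 1 = n%:R :> C.
Proof.
move=> n0; rewrite /natpow /= mul1r mul0r /cpolar cos0 sin0 mulr1 mulr0.
by rewrite lnK ?posrE ?ltr0n // complexr0 rmorph_nat.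
Qed.

Lemma natpowX p k s : (0 < p)%N -> natpow (p ^ k) s = natpow p s ^+ k.
Proof.
move=> p0; elim: k => [|k IHk].
  by rewrite expn0 expr0 /natpow ln1 !mulr0 expR0 /cpolar cos0 sin0 mulr1 mulr0.
rewrite expnS exprS -IHk /natpow cpolarM natrM lnM ?posrE ?ltr0n ?expn_gt0 ?p0 //.
by rewrite !mulrDr expRD.
Qed.

(** Cauchy condensation: the block 2^k <= n < 2^(k+1) contributes at most 2^k M(2^k) = r^k, with r =
    2^(1 - sigma) < 1. The index 0, where [ln] has a default value, is kept apart. *)
Lemma cvgn_series_natpow (sigma : R) : 1 < sigma ->
  cvgn (series (fun n => expR (- sigma * ln n%:R))).
Proof.
move=> s1; set M := (fun n => _).
have M0 n : 0 <= M n by apply: expR_ge0.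
have Mdec m n : (0 < m)%N -> (m <= n)%N -> M n <= M m.
  move=> m0 mn; rewrite /M ler_expR ler_nM2l ?oppr_lt0; last lra.
  by rewrite ler_ln ?posrE ?ltr0n ?ler_nat // (leq_trans m0).
set r : R := expR ((1 - sigma) * ln 2).
have r0 : 0 < r by apply: expR_gt0.
have r1 : r < 1 by rewrite -expR0 ltr_expR pmulr_llt0 ?ln_gt0 //; lra.
have M2 k : (2 ^ k)%:R * M (2 ^ k)%N = r ^+ k.
  have e2 : (2 ^ k)%:R = expR (ln ((2 ^ k)%:R : R)) by rewrite lnK // posrE ltr0n expn_gt0.
  rewrite {1}e2 /M -expRD -[r ^+ k]expRM_natl -{1}[ln _]mul1r -mulrDl natrX lnXn //.
  by congr expR; rewrite -mulr_natl; ring.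
have block k : \sum_(2 ^ k <= n < 2 ^ k.+1) M n <= r ^+ k.
  rewrite -M2 (le_trans (y := \sum_(2 ^ k <= n < 2 ^ k.+1) M (2 ^ k)%N)) //.
    by rewrite !big_nat ler_sum // => n /andP[h _]; apply: Mdec => //; rewrite expn_gt0.
  by rewrite sumr_const_nat expnS mul2n -addnn addnK mulr_natl.
have dy k : series M (2 ^ k)%N <= M 0%N + \sum_(j < k) r ^+ j.
  elim: k => [|k IHk]; first by rewrite /series /= expn0 big_nat1 big_ord0 addr0.
  rewrite /series /= (big_cat_nat _ (n := 2 ^ k)%N) //=; last by rewrite leq_exp2l.
  by rewrite big_ord_recr /= addrA lerD.
have ndM : nondecreasing_seq (series M).
  by apply/nondecreasing_seqP => n; rewrite seriesSr lerDl.
apply: nondecreasing_is_cvgn => //.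
exists (M 0%N + (1 - r)^-1) => _ [n _ <-].
rewrite (le_trans (ndM _ _ (ltnW (ltn_expl n (isT : 1 < 2)%N)))) // (le_trans (dy n)) //.
rewrite lerD2l -[leLHS]mulr1 -[X in _ * X](divff (x := 1 - r)); last by rewrite subr_eq0 gt_eqF.
rewrite mulrA ler_piMl ?invr_ge0 ?subr_ge0 ?ltW //.
have -> : (\sum_(j < n) r ^+ j) * (1 - r) = 1 - r ^+ n.
  by rewrite mulrC -opprB mulNr -subrX1 opprB.
by rewrite ltrBlDr ltrDl exprn_gt0.
Qed.

Lemma normc_natpow_le_half p s : (1 < p)%N -> 1 <= complex.Re s ->
  normc (natpow p (- s)) <= 2^-1.
Proof.
move=> p1 s1; rewrite normc_natpow.
have -> : complex.Re (- s) = - complex.Re s by case: s {s1}.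
rewrite -[leRHS]lnK ?posrE ?invr_gt0 // ler_expR lnV ?posrE // mulNr lerN2.
have l2 : ln 2 <= ln p%:R :> R by rewrite ler_ln ?posrE ?ltr0n ?ler_nat // ltnW.
have := ln_gt0 (_ : 1 < 2 :> R); rewrite ltr1n => /(_ isT) h.
by rewrite (le_trans l2) // ler_peMl // (le_trans _ l2) // ltW.
Qed.

Lemma prod_converges_natpow (P : pred nat) s : (forall n, P n -> (1 < n)%N) ->
  1 < complex.Re s ->
  prod_converges (fun N => \prod_(p < N.+1 | P p) (1 - natpow p (- s))^-1).
Proof.
move=> P2 s1; apply: (@prod_converges_euler P (fun p => natpow p (- s)) (fun n => expR (- complex.Re s * ln n%:R))).
- by move=> n; exact: expR_ge0.
- by move=> n _; rewrite normc_natpow; case: s {s1}.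
- by move=> n /P2 n1; apply: normc_natpow_le_half => //; exact: ltW.
- exact: cvgn_series_natpow.
Qed.

End ComplexLimits.

(** * Formal power series *)

Section FormalSeriesTheory.
Variable F : fieldType.
Implicit Types a b c e : nat -> F.

Lemma fps_mulE a b n : fps_mul a b n = \sum_(i < n.+1) a i * b (n - i)%N.
Proof.
rewrite /fps_mul coefM; apply: eq_bigr => i _.
by rewrite !coef_poly !ltnS leq_subr -ltnS ltn_ord.
Qed.

Lemma fps_mul_ext a a' b b' n : (forall i, (i <= n)%N -> a i = a' i) ->
  (forall i, (i <= n)%N -> b i = b' i) -> fps_mul a b n = fps_mul a' b' n.
Proof.
move=> ha hb; rewrite !fps_mulE; apply: eq_bigr => i _.
by rewrite ha -1?ltnS// hb // leq_subr.
Qed.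

Lemma fps_mul_trunc a b (p q : {poly F}) n : (forall i, (i <= n)%N -> a i = p`_i) ->
  (forall i, (i <= n)%N -> b i = q`_i) -> fps_mul a b n = (p * q)`_n.
Proof.
move=> ha hb; rewrite fps_mulE coefM; apply: eq_bigr => i _.
by rewrite ha -1?ltnS// hb // leq_subr.
Qed.

Lemma fps_mulC a b n : fps_mul a b n = fps_mul b a n.
Proof. by rewrite /fps_mul mulrC. Qed.

Lemma coef_fps_trunc a N i : (i <= N)%N -> (fps_trunc a N)`_i = a i.
Proof. by move=> iN; rewrite coef_poly ltnS iN. Qed.

Lemma fps_mulA a b c n : fps_mul a (fps_mul b c) n = fps_mul (fps_mul a b) c n.
Proof.
rewrite (@fps_mul_trunc _ _ (fps_trunc a n) (fps_trunc b n * fps_trunc c n)).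
- rewrite mulrA; apply/esym/fps_mul_trunc => i ile; last by rewrite coef_fps_trunc.
  by apply: fps_mul_trunc => j jle; rewrite coef_fps_trunc // (leq_trans jle).
- by move=> i ile; rewrite coef_fps_trunc.
- by move=> i ile; apply: fps_mul_trunc => j jle; rewrite coef_fps_trunc // (leq_trans jle).
Qed.

Definition fps_one (n : nat) : F := (n == 0%N)%:R.

Lemma fps_mul1 a n : fps_mul fps_one a n = a n.
Proof.
rewrite fps_mulE big_ord_recl /= mul1r subn0 big1 ?addr0 // => i _.
by rewrite /fps_one /= mul0r.
Qed.

(* Euler's derivation [T d/dT] *)
Definition fps_euler a (n : nat) : F := n%:R * a n.

Lemma fps_eulerM a b n :
  fps_euler (fps_mul a b) n = fps_mul (fps_euler a) b n + fps_mul a (fps_euler b) n.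
Proof.
rewrite /fps_euler !fps_mulE mulr_sumr -big_split /=; apply: eq_bigr => i _.
have {1}-> : n = (i + (n - i))%N by rewrite subnKC // -ltnS.
by rewrite natrD; ring.
Qed.

Lemma fps_mulDl a b c n :
  fps_mul (fun i => a i + b i) c n = fps_mul a c n + fps_mul b c n.
Proof. by rewrite !fps_mulE -big_split /=; apply: eq_bigr => i _; rewrite mulrDl. Qed.

Lemma fps_mulNl a c n : fps_mul (fun i => - a i) c n = - fps_mul a c n.
Proof. by rewrite !fps_mulE -sumrN; apply: eq_bigr => i _; rewrite mulNr. Qed.

(* [e = exp(a)], where [l = fps_euler a] *)
Definition fps_logderiv l e : Prop :=
  e 0%N = 1 /\ forall n, fps_euler e n = fps_mul l e n.

Hypothesis F0 : [pchar F] =i pred0.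

Lemma natr_fps_neq0 n : n.+1%:R != 0 :> F.
Proof. by rewrite ((pcharf0P F).1 F0). Qed.

(** The equation reads n e_n = sum_{i >= 1} l_i e_{n-i}, which in characteristic zero determines e_n
    recursively. *)
Lemma fps_logderiv_uniq l e e' : l 0%N = 0 -> fps_logderiv l e -> fps_logderiv l e' -> e =1 e'.
Proof.
move=> l0 [e0 he] [e0' he'] n; elim/ltn_ind: n => -[|n] IH; first by rewrite e0 e0'.
apply: (mulfI (natr_fps_neq0 n)); have := he n.+1; have := he' n.+1.
rewrite /fps_euler => -> ->; rewrite !fps_mulE big_ord_recl [in RHS]big_ord_recl /= l0 !mul0r !add0r.
by apply: eq_bigr => i _; rewrite IH // ltn_subrL.
Qed.

Lemma fps_logderivM l l' e e' : fps_logderiv l e -> fps_logderiv l' e' ->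
  fps_logderiv (fun n => l n + l' n) (fps_mul e e').
Proof.
move=> [e0 he] [e0' he']; split; first by rewrite fps_mulE big_ord1 e0 e0' mulr1.
move=> n; rewrite fps_eulerM fps_mulDl; congr (_ + _).
  by rewrite fps_mulA; apply: fps_mul_ext => // i _; exact: he.
rewrite fps_mulA [RHS](@fps_mul_ext _ (fps_mul e l') _ e') -?fps_mulA //.
  by apply: fps_mul_ext => // i _; exact: he'.
by move=> i _; rewrite fps_mulC.
Qed.

Lemma fps_logderiv_exp a : a 0%N = 0 -> fps_logderiv (fps_euler a) (fps_exp a).
Proof.
move=> a0; split.
  rewrite /fps_exp big_ord1 expr0 fact0 invr1 scale1r coefC //.
move=> n; set A := fps_trunc a n.
have A0 : A`_0 = 0 by rewrite coef_fps_trunc.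
have A'E : A = 'X * \poly_(i < n) a i.+1.
  apply/polyP => -[|i]; first by rewrite A0 coefXM.
  by rewrite coefXM /= !coef_poly ltnS.
have hX k (j : nat) : (j < k)%N -> (A ^+ k)`_j = 0.
  by move=> jk; rewrite A'E exprMn coefXnM jk.
(* [fps_exp] truncates at the index of the coefficient asked for; the powers k > j do not reach T^j,
   so the single order [n] serves for all j <= n. *)
have expE j : (j <= n)%N -> fps_exp a j = (\sum_(k < n.+1) (k`!%:R)^-1 *: A ^+ k)`_j.
  move=> jn; rewrite /fps_exp !coef_sum.
  rewrite -(subnKC (jn : (j.+1 <= n.+1)%N)) [RHS]big_split_ord /=.
  rewrite [X in _ = _ + X]big1 ?addr0; last first.
    by move=> i _; rewrite coefZ hX ?mulr0 // ltn_addr.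
  apply: eq_bigr => k _; rewrite !coefZ; congr (_ * _).
  have : forall i, (i <= j)%N -> (fps_trunc a j ^+ k)`_i = (A ^+ k)`_i.
    elim: (k : nat) => [//|m IHm] i ij; rewrite !exprS !coefM; apply: eq_bigr => r _.
    have rj : (r <= j)%N by rewrite (leq_trans _ ij) // -ltnS.
    rewrite IHm ?(leq_trans (leq_subr _ _)) //.
    by rewrite !coef_fps_trunc // (leq_trans rj).
  by apply.
set E := \sum_(k < n.+1) (k`!%:R)^-1 *: A ^+ k in expE.
rewrite (@fps_mul_trunc _ _ ('X * A^`()) E); last exact: expE; last first.
  move=> i ile; rewrite coefXM; case: i ile => [|i] ile; first by rewrite /fps_euler mul0r.
  by rewrite coef_deriv coef_fps_trunc // /fps_euler mulr_natl.
rewrite /fps_euler expE // -mulrA coefXM; case: n @A A0 A'E hX @E expE => [|n] A A0 A'E hX E expE.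
  by rewrite mul0r.
rewrite /= mulr_natl -coef_deriv.
have -> : E^`() = A^`() * \sum_(i < n.+1) (i`!%:R)^-1 *: A ^+ i.
  rewrite /E big_ord_recl expr0 derivD derivZ -polyC1 derivC scaler0 add0r.
  rewrite raddf_sum mulr_sumr; apply: eq_bigr => i _.
  rewrite /= /bump /= add1n derivZ deriv_exp /= -scalerAr factS natrM invfM.
  rewrite -scaler_nat scalerA mulrAC mulVf ?mul1r //.
  exact: natr_fps_neq0.
(* Differentiation loses the last power of [A]; that term starts beyond the coefficient
   considered. *)
rewrite /E [in RHS]big_ord_recr /= mulrDr coefD.
rewrite [X in _ = _ + X](_ : _ = 0) ?addr0 //.
rewrite -scalerAr coefZ [(A^`() * _)`__]coefM big1 ?mulr0 // => i _.
by rewrite hX ?mulr0 // ltnS leq_subr.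
Qed.


(** Geometric sum: A times sum_{k <= n} (1 - A)^k is 1 - (1 - A)^(n+1), and the last power has no
    coefficient up to order n. *)
Lemma fps_mul_inv a n : a 0%N = 1 -> fps_mul a (fps_inv a) n = fps_one n.
Proof.
move=> a0; set A := fps_trunc a n; set X := \sum_(k < n.+1) (1 - A) ^+ k.
have A0 : (1 - A)`_0 = 0 by rewrite coefB coef_fps_trunc // a0 coef1 subrr.
have hX (B : {poly F}) k (j : nat) : B`_0 = 0 -> (j < k)%N -> (B ^+ k)`_j = 0.
  move=> B0 jk; have -> : B = 'X * \poly_(i < (size B).-1) B`_i.+1.
    apply/polyP => -[|i]; rewrite coefXM //= coef_poly; case: ltnP => // h.
    by rewrite nth_default //; move: h; case: (size B).
  by rewrite exprMn coefXnM jk.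
rewrite (@fps_mul_trunc _ _ A X); first last.
- move=> j jn; rewrite /fps_inv /X !coef_sum.
  rewrite -(subnKC (jn : (j.+1 <= n.+1)%N)) [RHS]big_split_ord /=.
  rewrite [X in _ = _ + X]big1 ?addr0; last first.
    by move=> i _; rewrite hX // ltn_addr.
  apply: eq_bigr => k _.
  have : forall i, (i <= j)%N -> ((1 - fps_trunc a j) ^+ k)`_i = ((1 - A) ^+ k)`_i.
    elim: (k : nat) => [//|m IHm] i ij; rewrite !exprS !coefM; apply: eq_bigr => r _.
    have rj : (r <= j)%N by rewrite (leq_trans _ ij) // -ltnS.
    rewrite IHm ?(leq_trans (leq_subr _ _)) // !coefB.
    by rewrite !coef_fps_trunc // (leq_trans rj).
  by apply.
- by move=> i ile; rewrite coef_fps_trunc.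
have -> : A * X = 1 - (1 - A) ^+ n.+1.
  by rewrite -[RHS]opprB subrX1 -/X; ring.
by rewrite coefB hX // subr0 coef1.
Qed.

(** With X the inverse of e, applying T d/dT to e X = 1 gives e (T X' + l X) = 0, and multiplying by
    X cancels e. *)
Lemma fps_logderivV l e : fps_logderiv l e -> fps_logderiv (fun n => - l n) (fps_inv e).
Proof.
move=> [e0 he]; have eV n := @fps_mul_inv e n e0.
split; first by have := eV 0%N; rewrite fps_mulE big_ord1 e0 mul1r.
set X := fps_inv e in eV *.
have h n : fps_mul e (fun i => fps_euler X i + fps_mul l X i) n = 0.
  have : fps_euler (fps_mul e X) n = 0.
    by rewrite /fps_euler eV /fps_one; case: n => [|n]; rewrite ?mul0r //= mulr0.
  rewrite fps_eulerM [in X in _ -> X]fps_mulC fps_mulDl addrC => <-; congr (_ + _).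
    by rewrite fps_mulC.
  rewrite fps_mulC fps_mulA; apply: fps_mul_ext => // i _.
  by rewrite he fps_mulC.
move=> n; rewrite fps_mulNl; apply/eqP; rewrite -addr_eq0; apply/eqP.
rewrite -[LHS](fps_mul1 (fun i => fps_euler X i + fps_mul l X i)).
rewrite (@fps_mul_ext _ (fps_mul X e) _ (fun i => fps_euler X i + fps_mul l X i)) //.
  by rewrite -fps_mulA fps_mulE big1 // => i _; rewrite h mulr0.
by move=> i _; rewrite -eV fps_mulC.
Qed.

Lemma fps_logderiv_linear (c : F) :
  fps_logderiv (fun n => if n == 0%N then 0 else - c ^+ n) (fun n => (1 - c *: 'X)`_n).
Proof.
split; first by rewrite coefB coefZ coefX coef1 mulr0 subr0.
move=> n; rewrite fps_mulC fps_mulE /fps_euler.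
case: n => [|n]; first by rewrite big_ord1 mul0r mulr0.
rewrite !big_ord_recl big1 ?addr0 /=; last first.
  by move=> i _; rewrite coefB coefZ coefX coef1 /= mulr0 subr0 mul0r.
rewrite !coefB !coefZ !coefX !coef1 /= mulr0 subr0 mul1r sub0r mulr1.
rewrite subn0 /bump /= addn0 subSS subn0.
by case: n => [|n]; rewrite ?expr1 ?mulr1 /= ?exprS; ring.
Qed.

Lemma fps_logderiv_polyM l l' (p q : {poly F}) :
  fps_logderiv l (fun n => p`_n) -> fps_logderiv l' (fun n => q`_n) ->
  fps_logderiv (fun n => l n + l' n) (fun n => (p * q)`_n).
Proof.
move=> hp hq; have [h0 h1] := fps_logderivM hp hq.
have pq n : fps_mul (fun n => p`_n) (fun n => q`_n) n = (p * q)`_n.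
  by rewrite (@fps_mul_trunc _ _ p q).
split; first by rewrite -pq.
move=> n; rewrite /fps_euler -pq; have := h1 n; rewrite /fps_euler => ->.
by apply: fps_mul_ext => // i _; rewrite pq.
Qed.

End FormalSeriesTheory.

(** The recursion for (n+1) e_{n+1} has n+1 terms, each at most c^(i+1) (2c)^(n-i) <= (2c)^(n+1). *)
Lemma fps_logderiv_bound (R : realType) (l e : nat -> Cplx R) (c : R) :
  0 <= c -> l 0%N = 0 -> (forall n, (0 < n)%N -> normc (l n) <= c ^+ n) ->
  fps_logderiv l e -> forall n, normc (e n) <= (2 * c) ^+ n.
Proof.
move=> c0 l0 lc [e0 he]; elim/ltn_ind => -[|n] IH; first by rewrite e0 normc_cplx1.
have := he n.+1; rewrite /fps_euler fps_mulE big_ord_recl l0 mul0r add0r => h.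
have : n.+1%:R * normc (e n.+1) <= n.+1%:R * (2 * c) ^+ n.+1.
  rewrite -(normc_cplx_nat R n.+1) -normc_cplxM h normc_cplx_nat.
  rewrite (le_trans (normc_cplx_sum _ _ _)) //.
  have -> : n.+1%:R * (2 * c) ^+ n.+1 = \sum_(i < n.+1) (2 * c) ^+ n.+1.
    by rewrite sumr_const card_ord mulr_natl.
  rewrite ler_sum // => i _.
  rewrite normc_cplxM /= /bump /= add1n subSS.
  rewrite (le_trans (ler_pM _ _ (lc i.+1 isT) (IH (n - i)%N _))) ?normc_cplx_ge0 //.
    by rewrite ltnS leq_subr.
  have -> : (2 * c) ^+ n.+1 = (2 * c) ^+ i.+1 * (2 * c) ^+ (n - i).
    by rewrite -exprD addSn subnKC // -ltnS.
  rewrite ler_wpM2r ?exprn_ge0 ?mulr_ge0 // exprMn ler_peMl ?exprn_ge0 //.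
  by rewrite exprn_ege1 // ler1n.
by rewrite ler_pM2l // ltr0n.
Qed.

(** * Roots of unity and the exponents of the hypergeometric pair *)

Section RootsOfUnity.
Variable R : realType.

Lemma expi2piD a b : expi2pi R (a + b) = expi2pi R a * expi2pi R b.
Proof. by rewrite /expi2pi cpolarM mulr1 rmorphD mulrDr. Qed.

Lemma expi2pi0 : expi2pi R 0 = 1.
Proof. by rewrite /expi2pi rmorph0 mulr0 /cpolar cos0 sin0 mulr1 mulr0. Qed.

Lemma expi2pi1 : expi2pi R 1 = 1.
Proof.
by rewrite /expi2pi rmorph1 mulr1 /cpolar mulr_natl cos2pi sin2pi mulr1 mulr0.
Qed.

Lemma expi2piX a n : expi2pi R a ^+ n = expi2pi R (a *+ n).
Proof.
elim: n => [|n IHn]; first by rewrite expr0 mulr0n expi2pi0.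
by rewrite exprS IHn mulrS expi2piD.
Qed.

(** Since cos 2x = 1 - 2 sin^2 x, the value 1 would force sin(pi a) = 0, whereas sin is positive
    between 0 and pi. *)
Lemma expi2pi_neq1 (a : rat) : 0 < a < 1 -> expi2pi R a != 1.
Proof.
move=> /andP[a0 a1]; apply/eqP => -[] /[!mul1r] c1 _.
have ra0 : 0 < ratr a :> R by rewrite ltr0q.
have ra1 : ratr a < 1 :> R by rewrite -(rmorph1 (ratr : rat -> R)) ltr_rat.
have : 0 < sin (pi * ratr a : R).
  by rewrite sin_gt0_pi // mulr_gt0 ?pi_gt0 //= gtr_pMr ?pi_gt0.
have := c1; have -> : 2 * pi * ratr a = (pi * ratr a) *+ 2 :> R by ring.
rewrite cos_mulr2n cos2sin2 => h /lt0r_neq0; rewrite -sqrf_eq0 => /eqP; apply.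
by move: h; lra.
Qed.

Lemma expi2pi_prim n : (0 < n)%N -> n.-primitive_root (expi2pi R n%:R^-1).
Proof.
move=> n0; have n0' : n%:R != 0 :> rat by rewrite pnatr_eq0 -lt0n.
apply/andP; split=> //; apply/forallP => i; apply/eqP; rewrite unity_rootE expi2piX -(mulr_natl _ i.+1).
have [->|neq] := eqVneq i.+1 n; first by rewrite divff // expi2pi1 eqxx.
apply/negbTE/expi2pi_neq1; have lt : (i.+1 < n)%N by rewrite ltn_neqAle neq ltn_ord.
by rewrite divr_gt0 ?ltr0n //= ltr_pdivrMr ?ltr0n // mul1r ltr_nat.
Qed.

Lemma expi2pi_nat_div m n : expi2pi R (m%:R / n%:R) = expi2pi R n%:R^-1 ^+ m.
Proof. by rewrite mulr_natl expi2piX. Qed.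

Lemma cyc_poly_perm ps qs : perm_eq ps qs -> cyc_poly R ps = cyc_poly R qs.
Proof. by move=> h; exact: perm_big. Qed.

Lemma cyc_poly_cons p ps : cyc_poly R (p :: ps) = ('X^p - 1) * cyc_poly R ps.
Proof. by rewrite /cyc_poly big_cons. Qed.

Lemma cyc_poly_neq0 ps : all (leq 1) ps -> cyc_poly R ps != 0.
Proof.
move=> /allP h; rewrite /cyc_poly prodf_seq_neq0; apply/allP => p /h p0 /=.
by rewrite -size_poly_eq0 size_XnsubC.
Qed.

Lemma root_cyc_poly ps (x : Cplx R) : root (cyc_poly R ps) x = has (fun p => x ^+ p == 1) ps.
Proof.
elim: ps => [|p ps IH]; first by rewrite /cyc_poly big_nil (negbTE (root1 _)).
by rewrite cyc_poly_cons rootM IH /= /root !hornerE subr_eq0.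
Qed.

(* The largest exponent [n] is the largest order of a root of unity at which
   the product vanishes; it can thus be removed on both sides. *)
Lemma cyc_poly_inj ps qs : all (leq 1) ps -> all (leq 1) qs ->
  cyc_poly R ps = cyc_poly R qs -> perm_eq ps qs.
Proof.
have exroot n (rs : seq nat) : (0 < n)%N -> all (leq 1) rs ->
    root (cyc_poly R rs) (expi2pi R n%:R^-1) -> exists2 m, m \in rs & (n <= m)%N.
  move=> n0 /allP rs1; rewrite root_cyc_poly => /hasP[m mrs].
  rewrite -(prim_order_dvd (expi2pi_prim n0)) => nm; exists m => //.
  by rewrite dvdn_leq // rs1.
have rootn n (rs : seq nat) : (0 < n)%N -> n \in rs ->
    root (cyc_poly R rs) (expi2pi R n%:R^-1).
  move=> n0 nrs; rewrite root_cyc_poly; apply/hasP; exists n => //.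
  by rewrite prim_expr_order // expi2pi_prim.
elim: {ps}(size ps) {-2}ps qs (erefl (size ps)) => [|k IHk] ps qs sz ps1 qs1 e.
  move/size0nil: sz => ps0; rewrite ps0 in e *; case: qs qs1 e => // q qs qs1 e.
  have := rootn q (q :: qs) (allP qs1 q (mem_head _ _)) (mem_head _ _).
  by rewrite -e /cyc_poly big_nil (negbTE (root1 _)).
have [n nps nmax] : exists2 n, n \in ps & forall m, m \in ps -> (m <= n)%N.
  have exP : exists n, n \in ps by case: ps sz {ps1 e} => // p ps _; exists p; exact: mem_head.
  have ubP n : n \in ps -> (n <= \max_(m <- ps) m)%N.
    by move=> nps; apply: (@leq_bigmax_seq _ ps xpredT id).
  by case: (ex_maxnP exP ubP) => n nps nmax; exists n.
have n0 : (0 < n)%N := allP ps1 n nps.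
have [m mqs nm] := exroot n qs n0 qs1 (eq_ind _ (fun f => root f _) (rootn n ps n0 nps) _ e).
have m0 : (0 < m)%N := allP qs1 m mqs.
have [m' m'ps mm'] := exroot m ps m0 ps1 (eq_ind_r (fun f => root f _) (rootn m qs m0 mqs) e).
have mn : m = n by apply/eqP; rewrite eqn_leq nm (leq_trans mm') ?nmax.
rewrite mn in mqs => {m nm m0 m' m'ps mm' mn}.
have pps := perm_to_rem nps; have pqs := perm_to_rem mqs.
rewrite (permPl pps) (permPr pqs) perm_cons; apply: IHk.
- by rewrite size_rem // sz.
- by apply/allP => j /mem_rem /(allP ps1).
- by apply/allP => j /mem_rem /(allP qs1).
apply: (mulfI (x := 'X^n - 1)); first by rewrite -size_poly_eq0 size_XnsubC.
by rewrite -!cyc_poly_cons -(cyc_poly_perm pps) -(cyc_poly_perm pqs).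
Qed.

(** Cross-multiplying the two presentations of F/G gives equal products over [ps' ++ qs] and
    [ps ++ qs'], hence equal multisets; disjointness within each pair then separates numerators from
    denominators. Only an equality up to order can hold, as [exponents_of] is a choice. *)
Lemma cyc_exponents_uniq al be ps qs : cyc_exponents R al be (ps, qs) ->
  perm_eq (exponents_of R al be).1 ps /\ perm_eq (exponents_of R al be).2 qs.
Proof.
move=> h; have := @xgetPex _ ([::], [::]) _ (ex_intro _ (ps, qs) h : exists x, [set pq | cyc_exponents R al be pq]%classic x).
rewrite -/(exponents_of R al be); case: (exponents_of R al be) => ps' qs' /= [/= p1' q1' d' e'].
have [/= p1 q1 d e] := h.
have nz (s : seq rat) : param_poly R s != 0.
  by rewrite /param_poly prodf_seq_neq0; apply/allP => a _ /=; rewrite polyXsubC_eq0.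
have : perm_eq (ps' ++ qs) (ps ++ qs').
  apply: cyc_poly_inj; rewrite ?all_cat ?p1 ?q1 ?p1' ?q1' //.
  apply: (mulfI (mulf_neq0 (nz al) (nz be))).
  rewrite /cyc_poly !big_cat /= -!/(cyc_poly R _).
  have -> : param_poly R al * param_poly R be * (cyc_poly R ps' * cyc_poly R qs) =
    (param_poly R al * cyc_poly R qs) * (param_poly R be * cyc_poly R ps') by ring.
  by rewrite e -e'; ring.
move=> /permP hc.
have dis (s t : seq nat) : ~~ has (mem s) t -> forall x, (x \in s) -> (x \in t) = false.
  by move=> /hasPn hst x xs; apply/negP => /hst /=; rewrite xs.
have cnt x : (count_mem x ps' = count_mem x ps /\ count_mem x qs' = count_mem x qs)%N.
  have := hc (pred1 x); rewrite !count_cat.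
  have z (s : seq nat) : x \notin s -> count_mem x s = 0%N by move=> /count_memPn.
  have [xp|/z->] := boolP (x \in ps'); have [xp2|/z->] := boolP (x \in ps).
  - by rewrite (z qs) ?(z qs') ?(dis _ _ d) ?(dis _ _ d') // !addn0.
  - rewrite (z qs') ?(dis _ _ d') //; case: (count_mem x qs) => [|k]; first by rewrite addn0.
    by move=> h2; exfalso; move: h2; rewrite !addn0 addnS.
  - rewrite (z qs) ?(dis _ _ d) //; case: (count_mem x qs') => [|k]; first by rewrite !addn0.
    by move=> h2; exfalso; move: h2; rewrite !add0n addnS.
  - by rewrite !add0n.
by split; apply/allP => x _ /=; rewrite ?(cnt x).1 ?(cnt x).2.
Qed.


Lemma param_poly_iota n : (0 < n)%N ->
  param_poly R [seq k%:R / n%:R | k <- iota 1 n] = 'X^n - 1.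
Proof.
move=> n0; rewrite -(factor_Xn_sub_1 (expi2pi_prim n0)) /param_poly big_map.
rewrite (eq_bigr (fun k => 'X - (expi2pi R n%:R^-1 ^+ k)%:P)); last first.
  by move=> k _; rewrite expi2pi_nat_div.
case: n n0 => // n _; rewrite -[iota 1 n.+1]/(index_iota 1 n.+2).
rewrite big_nat_recr //= [RHS]big_nat_recl // big_add1 /= mulrC.
by rewrite prim_expr_order ?expi2pi_prim // expr0.
Qed.

(** Both sides are products over the same multiset of rationals: the fractions k/27 with 3 dividing
    k are the k/9, and [hgm_beta] collects the k/6, k/7 and k/5. The equality of multisets is
    decided by computation. *)
Lemma hgm_cyc_exponents :
  cyc_exponents R hgm_alpha hgm_beta ([:: 27], [:: 9; 6; 7; 5])%N.
Proof.
pose L n : seq rat := [seq k%:R / n%:R | k <- iota 1 n].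
split=> //=.
rewrite /cyc_poly !big_cons !big_nil !mulr1 -!param_poly_iota // /param_poly.
rewrite -!big_cat; apply: perm_big.
by vm_compute.
Qed.

(** A double root would annihilate 27 x^26, so roots of D are simple. As gcd(27, k) divides 9 for k
    = 9, 6, 7, 5, they are exactly the ninth roots of unity. Here n.+1 is the size of the field. *)
Lemma hgm_root_mult (qs : seq nat) n m : (0 < n)%N -> perm_eq qs [:: 9; 6; 7; 5]%N ->
  root_mult R [:: 27] qs n.+1 m = (n %| 9 * m)%N.
Proof.
move=> n0 hqs; rewrite /root_mult (cyc_poly_perm hqs) /= expi2pi_nat_div.
set x := _ ^+ m; set D := gcdp _ _.
have p27 : cyc_poly R [:: 27] = 'X^27 - 1 by rewrite /cyc_poly big_seq1.
have nz27 : cyc_poly R [:: 27] != 0 by apply: cyc_poly_neq0.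
have D0 : D != 0 by rewrite gcdp_eq0 negb_and nz27.
have m1 : (mup x D <= 1)%N.
  rewrite leqNgt mup_geq //; apply/negP => /dvdp_trans /(_ (dvdp_gcdl _ _)).
  rewrite p27 => /dvdpP[q h].
  have r : root ('X^27 - 1) x by rewrite h rootM -[X in _ || X]/(_ == 0) horner_exp !hornerE subrr expr0n eqxx orbT.
  have : root (('X^27 - 1 : {poly Cplx R})^`()) x.
    by rewrite h expr2 !derivM /root !(hornerD, hornerM, hornerN, hornerX, hornerC) subrr
      !(mulr0, mul0r, addr0).
  rewrite derivB derivXn -polyC1 derivC subr0 /root hornerMn hornerXn.
  rewrite mulrn_eq0 /= expf_eq0 /= => /eqP x0.
  by move: r; rewrite x0 /root hornerD hornerN hornerC hornerXn expr0n sub0r oppr_eq0 oner_eq0.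
have -> : mup x D = root D x :> nat.
  rewrite -dvdp_XsubCl -[_ - _]expr1 -mup_geq //.
  by case: (mup x D) m1 => [|[]].
rewrite root_gcd !root_cyc_poly /= !orbF (prim_order_dvd (expi2pi_prim n0)) mulnC exprM -/x.
congr nat_of_bool; apply/idP/idP => [/andP[/eqP x27]|/eqP x9]; last first.
  by rewrite x9 eqxx andbT (exprM x 9 3) x9 expr1n.
have x54 : x ^+ 54 = 1 by rewrite (exprM x 27 2) x27 expr1n.
case/or4P => /eqP h; apply/eqP => //.
- have x24 : x ^+ 24 = 1 by rewrite (exprM x 6 4) h expr1n.
  have : x ^+ 27 = x ^+ 24 * x ^+ 3 by rewrite -exprD.
  by rewrite x27 x24 mul1r => h3; rewrite (exprM x 3 3) -h3 expr1n.
- have x28 : x ^+ 28 = 1 by rewrite (exprM x 7 4) h expr1n.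
  have : x ^+ 28 = x ^+ 27 * x by rewrite -exprSr.
  by rewrite x27 x28 mul1r => <-; rewrite expr1n.
- have x55 : x ^+ 55 = 1 by rewrite (exprM x 5 11) h expr1n.
  have : x ^+ 55 = x ^+ 54 * x by rewrite -exprSr.
  by rewrite x54 x55 mul1r => <-; rewrite expr1n.
Qed.

End RootsOfUnity.

(** * Character sums *)

Lemma mulr_sum_pair (A : pzRingType) (I J : finType) (P : pred I) (Q : pred J)
    (f : I -> A) (g : J -> A) :
  (\sum_(i | P i) f i) * (\sum_(j | Q j) g j) =
  \sum_(p : I * J | P p.1 && Q p.2) f p.1 * g p.2.
Proof. by rewrite big_distrlr /= pair_big. Qed.

Section CharacterSums.
Variables (R : realType) (F : finFieldType).
Local Notation C := (Cplx R).
Local Notation q := #|F|.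
Variables omega Theta : F -> C.
Hypothesis homega : generates_mult_characters omega.
Hypothesis hTheta : nontrivial_add_character Theta.

Lemma sum_nonzero_const (c : C) : \sum_(x : F | x != 0) c = (q.-1)%:R * c.
Proof.
rewrite sumr_const mulr_natl; congr (_ *+ _).
exact: cardC1.
Qed.

Lemma add_char0 : Theta 0 = 1.
Proof.
have [h0 hD _] := hTheta; apply: (mulfI (h0 0)).
by rewrite -hD addr0 mulr1.
Qed.

Lemma add_charD x y : Theta (x + y) = Theta x * Theta y.
Proof. by case: hTheta. Qed.

Lemma sum_add_char : \sum_x Theta x = 0.
Proof.
have [h0 hD [a a1]] := hTheta; apply/eqP; rewrite -(mulIr_eq0 _ (mulIf (x := Theta a - 1) _)) ?subr_eq0 //.
rewrite mulrBr mulr1 subr_eq0; apply/eqP; rewrite mulr_suml.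
rewrite [RHS](reindex_inj (addIr a)) /=.
by apply: eq_bigr => x _; rewrite hD.
Qed.

Lemma sum_nonzero_add_char : \sum_(x | x != 0) Theta x = -1.
Proof. by have := sum_add_char; rewrite (bigD1 0) //= add_char0 => /eqP; rewrite addrC addr_eq0 => /eqP. Qed.

Lemma sum_add_char_mul a : \sum_(w | w != 0) Theta (w * a) = q%:R * (a == 0)%:R - 1.
Proof.
have [->|a0] := eqVneq a 0.
  under eq_bigr do rewrite mulr0 add_char0.
  rewrite sum_nonzero_const !mulr1 -subn1 natrB //.
  by apply/card_gt0P; exists 0.
rewrite mulr0 sub0r -sum_nonzero_add_char [RHS](reindex_inj (mulIf a0)) /=.
by apply: eq_bigl => w; rewrite mulf_eq0 (negbTE a0) orbF.
Qed.

Lemma finField_prim_root : exists g : F, q.-1.-primitive_root g.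
Proof.
have q1 : (0 < q.-1)%N by have := finNzRing_gt1 F; case: q => [|[]].
have := @has_prim_root F q.-1 [seq x <- enum F | predC1 0 x] q1.
have -> : all q.-1.-unity_root [seq x <- enum F | predC1 0 x].
  apply/allP => x; rewrite mem_filter => /andP[/= x0 _].
  rewrite unity_rootE; apply/eqP/(mulfI x0); rewrite mulr1 -exprS prednK ?expf_card //.
  by apply/card_gt0P; exists 0.
rewrite filter_uniq ?enum_uniq //.
have -> : (q.-1 <= size [seq x <- enum F | predC1 0%R x])%N.
  rewrite -(cardC1 (0 : F)) cardE; apply: eq_leq; congr size.
  by rewrite /enum_mem -filter_predI; apply: eq_filter => x; rewrite /= !inE andbT.
by move=> /(_ isT isT isT) /hasP[g _]; exists g.
Qed.

Lemma expf_card_pred (x : F) : x != 0 -> x ^+ q.-1 = 1.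
Proof.
move=> x0; apply/(mulfI x0); rewrite mulr1 -exprS prednK ?expf_card //.
by apply/card_gt0P; exists 0.
Qed.

Lemma mult_charM x y : x != 0 -> y != 0 -> omega (x * y) = omega x * omega y.
Proof. by have [[_ h] _] := homega; apply: h. Qed.

Lemma mult_char_neq0 x : x != 0 -> omega x != 0.
Proof. by have [[h _] _] := homega; apply: h. Qed.

Lemma mult_char1 : omega 1 = 1.
Proof.
have o0 := mult_char_neq0 (oner_neq0 F); apply: (mulfI o0).
by rewrite -mult_charM ?oner_neq0 // !mulr1.
Qed.

Lemma mult_charX x n : x != 0 -> omega (x ^+ n) = omega x ^+ n.
Proof.
move=> x0; elim: n => [|n IHn]; first by rewrite !expr0 mult_char1.
by rewrite !exprS mult_charM ?IHn // expf_neq0.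
Qed.

Lemma mult_charV x : x != 0 -> omega x^-1 = (omega x)^-1.
Proof.
move=> x0; apply: (mulfI (mult_char_neq0 x0)).
by rewrite -mult_charM ?invr_neq0 // divff // mult_char1 divff // mult_char_neq0.
Qed.

(** The discrete logarithm to a generator g yields one faithful character [chi]; being a power of
    omega, it is trivial wherever omega is. *)
Lemma mult_char_faithful x : x != 0 -> omega x = 1 -> x = 1.
Proof.
have q1 : (0 < q.-1)%N by have := finNzRing_gt1 F; case: q => [|[]].
have [g gp] := finField_prim_root; have zp := expi2pi_prim R q1.
set z := expi2pi R _ in zp.
have log y : y != 0 -> exists2 i, (i < q.-1)%N & y = g ^+ i.
  by move=> /expf_card_pred /(prim_rootP gp)[i ->]; exists (val i); first exact: ltn_ord.
pose lg y := xget 0%N [set i | y = g ^+ i].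
have lgE y : y != 0 -> y = g ^+ lg y.
  by move=> /log[i _ ->]; exact: (@xgetPex _ 0%N [set j | g ^+ i = g ^+ j]%classic (ex_intro _ i erefl)).
pose chi y := z ^+ lg y.
have z0 : z != 0 by rewrite (prim_root_eq0 zp) -lt0n.
have chiP : mult_character chi.
  split=> [y _|y1 y2 h1 h2]; first exact: expf_neq0.
  rewrite /chi -exprD; apply/eqP; rewrite (eq_prim_root_expr zp) -(eq_prim_root_expr gp).
  by rewrite exprD -!lgE // mulf_neq0.
have [k hk] := homega.2 chi chiP.
move=> x0 ox; have : chi x = 1 by rewrite hk // ox exp1rz.
move=> /eqP; rewrite /chi -(prim_order_dvd zp) => /(dvdn_trans _).
by move=> d; rewrite (lgE x x0); apply/eqP; rewrite -(prim_order_dvd gp) d.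
Qed.

Lemma sum_mult_char_pow x : x != 0 ->
  \sum_(m < q.-1) omega x ^+ m = (q.-1)%:R * (x == 1)%:R.
Proof.
move=> x0; have [->|x1] := eqVneq x 1.
  under eq_bigr do rewrite mult_char1 expr1n.
  by rewrite sumr_const card_ord mulr1.
rewrite mulr0; apply: (mulfI (x := omega x - 1)).
  by rewrite subr_eq0; apply: contra x1 => /eqP /(mult_char_faithful x0) ->.
by rewrite -subrX1 -mult_charX // expf_card_pred // mult_char1 subrr mulr0.
Qed.

(** Substituting g x for x, with g a generator, multiplies the sum by omega(g^k), which differs from
    1 unless q - 1 divides k. *)
Lemma sum_mult_char_powl k :
  \sum_(x | x != 0) omega x ^+ k = (q.-1)%:R * (q.-1 %| k)%N%:R.
Proof.
have [g gp] := finField_prim_root.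
have g0 : g != 0.
  rewrite (prim_root_eq0 gp) -lt0n.
  by have := finNzRing_gt1 F; case: q => [|[]].
rewrite (prim_order_dvd gp); have [gk|gk] := eqVneq (g ^+ k) 1.
  rewrite mulr1 -[RHS]mulr1 -sum_nonzero_const; apply: eq_bigr => x x0.
  have [i ->] := prim_rootP gp (expf_card_pred x0).
  by rewrite -mult_charX ?expf_neq0 // -exprM mulnC exprM gk expr1n mult_char1.
rewrite mulr0; apply: (mulfI (x := omega (g ^+ k) - 1)).
  rewrite subr_eq0; apply: contra gk => /eqP /mult_char_faithful -> //.
  exact: expf_neq0.
rewrite mulr0 mulrBl mul1r; apply/eqP; rewrite subr_eq0; apply/eqP.
rewrite [RHS](reindex_inj (mulfI g0)) /= mulr_sumr; apply: eq_big => x.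
  by rewrite mulf_eq0 (negbTE g0).
by move=> x0; rewrite mult_charM // exprMn mult_charX.
Qed.

Lemma gauss_sum_nat (r m : nat) :
  gauss_sum omega Theta (r * m)%N%:Z = \sum_(x | x != 0) omega (x ^+ r) ^+ m * Theta x.
Proof. by apply: eq_bigr => x x0; rewrite mult_charX // -exprM. Qed.

Lemma gauss_sum_opp (r m : nat) :
  gauss_sum omega Theta (- (r * m)%N%:Z) = \sum_(x | x != 0) omega (x ^- r) ^+ m * Theta x.
Proof.
apply: eq_bigr => x x0; rewrite mult_charV ?expf_neq0 // mult_charX //.
by rewrite exprVn -exprM -exprnN.
Qed.

(* In the order [x4, x0, x1, x2, x3], where [x4] goes with the monomial
   [u = x0 x1 x2 x3] of the quartic. *)
Local Notation T5 := (F * F * F * F * F)%type.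
Definition nz5 (p : T5) :=
  [&& (p.1.1.1.1 != 0) && (p.1.1.1.2 != 0) && (p.1.1.2 != 0) && (p.1.2 != 0) & p.2 != 0].
Definition sum5 (p : T5) := p.1.1.1.1 + p.1.1.1.2 + p.1.1.2 + p.1.2 + p.2.
Definition monomial5 (p : T5) :=
  p.1.1.1.1 ^+ 27 * p.1.1.1.2 ^- 9 * p.1.1.2 ^- 6 * p.1.2 ^- 7 * p.2 ^- 5.

Lemma prod_gauss_sums m :
  gauss_sum omega Theta (27 * m)%N%:Z *
    (gauss_sum omega Theta (- (9 * m)%N%:Z) * (gauss_sum omega Theta (- (6 * m)%N%:Z) *
    (gauss_sum omega Theta (- (7 * m)%N%:Z) * gauss_sum omega Theta (- (5 * m)%N%:Z)))) =
  \sum_(p | nz5 p) omega (monomial5 p) ^+ m * Theta (sum5 p).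
Proof.
rewrite !mulrA gauss_sum_nat !gauss_sum_opp !mulr_sum_pair.
apply: eq_bigr => -[[[[a b] c] d] e] /= /andP[/andP[/andP[/andP[a0 b0] c0] d0] e0].
rewrite /sum5 /monomial5 /= !add_charD !mult_charM ?mulf_neq0 ?invr_neq0 ?expf_neq0 //.
by rewrite !exprMn; ring.
Qed.

Lemma sum_nz5_mult_char (u : F) : u != 0 ->
  \sum_(m < q.-1) (\sum_(p | nz5 p) omega (monomial5 p) ^+ m * Theta (sum5 p)) * omega u ^+ m =
  (q.-1)%:R * \sum_(p | nz5 p && (monomial5 p * u == 1)) Theta (sum5 p).
Proof.
move=> u0; under eq_bigr do rewrite mulr_suml.
rewrite exchange_big /= [in RHS]big_mkcondr mulr_sumr; apply: eq_bigr => p p0.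
have mp0 : monomial5 p != 0.
  case: p p0 => [[[[a b] c] d] e] /andP[/andP[/andP[/andP[/= a0 b0] c0] d0] /= e0].
  by rewrite /monomial5 /= ?mulf_neq0 ?invr_neq0 ?expf_neq0.
rewrite (eq_bigr (fun m : 'I_q.-1 => omega (monomial5 p * u) ^+ m * Theta (sum5 p))); last first.
  by move=> m _; rewrite mult_charM // exprMn; ring.
rewrite -mulr_suml (sum_mult_char_pow (mulf_neq0 mp0 u0)).
by case: eqP => _; rewrite ?mulr1 // mulr0 mul0r.
Qed.

End CharacterSums.

(** * Points of the surface *)

Section PointCount.
Variables (F : finFieldType) (c : F).
Local Notation q := #|F|.

(** The quartic at x3 = 1, with [c] in place of -27 psi. Below, [curve_eq] is its restriction to x0
    = 0, and [cube_roots] counts its zeros on x0 = x1 = 0, that is the z with z^3 = -1. *)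
Definition affine_eq (x y z : F) := x ^+ 3 * y + y ^+ 3 * z + z ^+ 3 + 1 + c * (x * y * z).
Definition curve_eq (y z : F) := y ^+ 3 * z + z ^+ 3 + 1.

Definition torus_count := (\sum_(x | x != 0%R) \sum_(y | y != 0%R) \sum_(z | z != 0%R)
  (affine_eq x y z == 0%R))%N.
Definition curve_count := (\sum_(y | y != 0%R) \sum_(z | z != 0%R) (curve_eq y z == 0%R))%N.
Definition cube_roots := (\sum_(z : F) ((z ^+ 3 + 1)%R == 0%R))%N.

Lemma sum_nat_pred1 (P : pred F) (a : F) : P a -> (\sum_(z | P z) (z == a : nat) = 1)%N.
Proof.
move=> Pa; rewrite (bigD1 a) //= eqxx big1 // => z /andP[_ /negbTE->] //.
Qed.

Lemma card_nonzero : #|(fun i : F => i != 0%R)| = q.-1.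
Proof. exact: cardC1. Qed.

Lemma card_field_gt0 : (0 < q)%N.
Proof. by apply/card_gt0P; exists 0. Qed.

(** The plane y = 0 gives [cube_roots] solutions for each x. For y nonzero, x = 0 leaves the curve,
    since z = 0 is then impossible; for x and y nonzero, z = 0 forces y = - x^-3, whence the term q
    - 1. *)
Lemma affine_count :
  (\sum_(x : F) \sum_(y : F) \sum_(z : F) (affine_eq x y z == 0%R) =
   q * cube_roots + curve_count + q.-1 + torus_count)%N.
Proof.
rewrite (bigD1 0%R) //=.
have -> : (\sum_(y : F) \sum_(z : F) (affine_eq 0%R y z == 0%R) = cube_roots + curve_count)%N.
  rewrite (bigD1 0%R) //=; congr (_ + _)%N.
    by apply: eq_bigr => z _; rewrite /affine_eq expr0n /= !(mul0r, add0r, mulr0, addr0).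
  apply: eq_bigr => y y0; rewrite (bigD1 0%R) //= {1}/affine_eq.
  rewrite expr0n /= !(mul0r, add0r, mulr0, addr0) oner_eq0 add0n.
  by apply: eq_bigr => z _; rewrite /affine_eq /curve_eq expr0n /= !(mul0r, add0r, mulr0, addr0).
rewrite (eq_bigr (fun x => cube_roots + (1 + \sum_(y | y != 0%R) \sum_(z | z != 0%R)
    (affine_eq x y z == 0%R)))%N); last first.
  move=> x x0; rewrite (bigD1 0%R) //=; congr (_ + _)%N.
    by apply: eq_bigr => z _; rewrite /affine_eq expr0n /= !(mul0r, add0r, mulr0, addr0).
  rewrite (eq_bigr (fun y => (y == - x ^- 3) + \sum_(z | z != 0%R) (affine_eq x y z == 0%R))%N); last first.
    move=> y y0; rewrite (bigD1 0%R) //=; congr (nat_of_bool _ + _)%N.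
    rewrite /affine_eq expr0n /= !(mul0r, add0r, mulr0, addr0).
    have x3 : x ^+ 3 != 0 by rewrite expf_neq0.
    by rewrite -[RHS](inj_eq (mulfI x3)) mulrN mulfV // -[RHS]subr_eq0 opprK.
  rewrite big_split /= sum_nat_pred1 //.
  by rewrite oppr_eq0 invr_eq0 expf_neq0.
rewrite big_split /= big_split /= !sum_nat_const card_nonzero muln1.
have := card_field_gt0; set N := (\sum_(i | i != 0%R) _)%N; rewrite -[torus_count]/N.
by move: N; case: q => // k N _; rewrite mulSn /=; lia.
Qed.

(** The cone over the section x3 = 0. Its equation is linear in z when y is nonzero and holds for
    all x, z when y = 0. *)
Lemma boundary_count :
  (\sum_(x : F) \sum_(y : F) \sum_(z : F) ((x ^+ 3 * y + y ^+ 3 * z)%R == 0%R) = q * q + q * q.-1)%N.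
Proof.
transitivity (\sum_(x : F) (q + q.-1))%N; last by rewrite sum_nat_const mulnDr.
apply: eq_bigr => x _; rewrite (bigD1 0%R) //=; congr (_ + _)%N.
  rewrite -[RHS]muln1 -sum_nat_const; apply: eq_bigr => z _.
  by rewrite expr0n mulr0 mul0r addr0 eqxx.
rewrite -[RHS]muln1 -card_nonzero -sum_nat_const; apply: eq_bigr => y y0.
have y3 : y ^+ 3 != 0 by rewrite expf_neq0.
transitivity (\sum_(z : F) (z == (- (x ^+ 3 * y) / y ^+ 3)%R))%N; last exact: sum_nat_pred1.
apply: eq_bigr => z _.
by rewrite -[in RHS](inj_eq (mulfI y3)) mulrCA divff // mulr1 -addr_eq0 addrC.
Qed.

End PointCount.

(** * From affine to projective points *)

Section ProjectiveCount.
Variable F : finFieldType.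
Local Notation q := #|F|.

Definition punctured_line (n : nat) (x : 'rV[F]_n) : {set 'rV[F]_n} :=
  [set a *: x | a : F & a != 0]%SET.

Lemma card_lines (n : nat) (V : pred 'rV[F]_n) :
  (forall (a : F) x, a != 0 -> V (a *: x) = V x) ->
  (#|[set punctured_line x | x : 'rV[F]_n & (x != 0%R) && V x]%SET| * q.-1 =
   #|[pred x : 'rV[F]_n | (x != 0%R) && V x]|)%N.
Proof.
move=> VZ; set line := @punctured_line n.
set A : {set 'rV[F]_n} := [set x | (x != 0) && V x]%SET.
have -> : [set line x | x : 'rV[F]_n & (x != 0) && V x]%SET = (line @: A)%SET.
  by apply/setP => y; apply/imsetP/imsetP => -[x hx ->]; exists x; move: hx; rewrite ?inE.
have -> : #|[pred x : 'rV[F]_n | (x != 0) && V x]| = #|A| by apply: eq_card => x; rewrite !inE.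
rewrite -[RHS]sum1_card (partition_big_imset line) /= -sum_nat_const.
apply: eq_bigr => _ /imsetP[x xA ->]; rewrite sum1dep_card.
have [x0 Vx] : x != 0 /\ V x by move: xA; rewrite inE => /andP[].
have -> : [set i | (i \in A) && (line i == line x)]%SET = line x.
  apply/setP => y; rewrite !inE; apply/idP/idP => [/andP[_ /eqP <-]|].
    by apply/imsetP; exists 1; rewrite ?inE ?oner_neq0 // scale1r.
  move=> /imsetP[a]; rewrite inE => a0 ->; rewrite scaler_eq0 negb_or a0 x0 VZ // Vx /=.
  apply/eqP/setP => z; apply/imsetP/imsetP => -[b]; rewrite inE => b0 ->.
    by exists (b * a); rewrite ?inE ?mulf_neq0 // scalerA.
  by exists (b / a); rewrite ?inE ?mulf_neq0 ?invr_neq0 // scalerA divfK.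
rewrite card_in_imset; first by rewrite -card_nonzero; apply: eq_card => y; rewrite !inE.
move=> a b _ _ /eqP; rewrite -subr_eq0 -scalerBl scaler_eq0 (negbTE x0) orbF subr_eq0.
by move/eqP.
Qed.

(** Nonzero vectors of the cone are counted and divided by q - 1. Each w = x3 nonzero rescales to w
    = 1; the slice w = 0 without the origin contributes q^2 + q (q - 1) - 1 = (2q + 1)(q - 1), and
    2q + 1 joins the q - 1 of [affine_count] to form 3q. *)
Lemma card_surface_points (psi : F) :
  (#|surface_points psi| = torus_count (- (27%:R * psi)) + curve_count F + 3 * q + q * cube_roots F)%N.
Proof.
set c := - (27%:R * psi).
have q1 : (0 < q.-1)%N by have := finNzRing_gt1 F; case: q => [|[]].
apply/eqP; rewrite -(eqn_pmul2r q1) /surface_points; apply/eqP.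
rewrite (@card_lines _ (fun x => quartic psi x == 0)); last first.
  move=> a x a0; have -> : quartic psi (a *: x) = a ^+ 4 * quartic psi x.
    by rewrite /quartic !mxE; ring.
  by rewrite mulf_eq0 expf_eq0 /= (negbTE a0).
pose Q (x y z w : F) := x ^+ 3 * y + y ^+ 3 * z + z ^+ 3 * w + w ^+ 4 + c * (x * y * z * w).
have tot : (\sum_(w : F) \sum_(x : F) \sum_(y : F) \sum_(z : F) (Q x y z w == 0%R) =
            (#|[pred x : 'rV[F]_4 | (x != 0%R) && (quartic psi x == 0%R)]|).+1)%N.
  pose f (p : F * F * F * F) : 'rV[F]_4 := \row_i [:: p.1.1.2; p.1.2; p.2; p.1.1.1]`_i.
  pose g (x : 'rV[F]_4) := (x 0 (inord 3), x 0 (inord 0), x 0 (inord 1), x 0 (inord 2)).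
  have fg : cancel f g.
    by move=> [[[w x] y] z]; rewrite /f /g !mxE !inordK.
  have gf : cancel g f.
    move=> x; apply/rowP => i; rewrite !mxE /=.
    by case: i => -[|[|[|[|//]]]] h /=; congr (x _ _); apply/val_inj; rewrite /= inordK.
  transitivity (\sum_(x : 'rV[F]_4) (quartic psi x == 0%R))%N.
    rewrite [RHS](reindex f) /=; last by apply: onW_bij; exists g.
    rewrite pair_big /= pair_big /= pair_big /=; apply: eq_bigr => -[[[w x] y] z] _.
    congr (nat_of_bool (_ == _)).
    by rewrite /quartic /f /Q !mxE /= !inordK //= /c; ring.
  rewrite (bigD1 0%R) //=.
  have -> : quartic psi 0 == 0 by rewrite /quartic !mxE !(expr0n, mulr0, addr0, subr0).
  rewrite add1n -sum1_card; congr _.+1; rewrite [RHS]big_mkcond [LHS]big_mkcond /=.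
  by apply: eq_bigr => x _; rewrite inE; case: (x != 0) => //=; case: (_ == 0).
apply/eqP; rewrite -eqSS -tot; apply/eqP.
rewrite (bigD1 0%R) //=.
have -> : (\sum_(x : F) \sum_(y : F) \sum_(z : F) (Q x y z 0%R == 0%R) = q * q + q * q.-1)%N.
  rewrite -boundary_count; apply: eq_bigr => x _; apply: eq_bigr => y _; apply: eq_bigr => z _.
  by rewrite /Q !expr0n /= !(mulr0, addr0).
rewrite (eq_bigr (fun=> q * cube_roots F + curve_count F + q.-1 + torus_count c)%N); last first.
  move=> w w0; rewrite -affine_count (reindex_inj (mulIf w0)); apply: eq_bigr => x _.
  rewrite (reindex_inj (mulIf w0)); apply: eq_bigr => y _.
  rewrite (reindex_inj (mulIf w0)); apply: eq_bigr => z _.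
  have -> : Q (x * w) (y * w) (z * w) w = w ^+ 4 * affine_eq c x y z.
    by rewrite /Q /affine_eq; ring.
  by rewrite mulf_eq0 expf_eq0 /= (negbTE w0).
rewrite sum_nat_const card_nonzero; have := card_field_gt0 F.
case: (q) q1 => // k; rewrite /= => k0 _; nia.
Qed.

Lemma cube_rootsE (g : F) : q.-1.-primitive_root g ->
  cube_roots F = if (3 %| q.-1)%N then 3 else 1.
Proof.
move=> gp; have q1 : (0 < q.-1)%N by have := finNzRing_gt1 F; case: q => [|[]].
rewrite /cube_roots (reindex_inj oppr_inj) /=.
rewrite (eq_bigr (fun z : F => (z ^+ 3 == 1%R) : nat)); last first.
  move=> z _; congr nat_of_bool; rewrite -[RHS](inj_eq oppr_inj) -[RHS]subr_eq0 opprK.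
  by congr (_ == 0); ring.
rewrite -big_mkcond /= sum1dep_card.
case: ifPn => h3.
  have zp := dvdn_prim_root gp h3; set z := g ^+ _ in zp.
  have -> : [set x : F | x ^+ 3 == 1]%SET = [set z ^+ i | i : 'I_3]%SET.
    apply/setP => x; rewrite inE; apply/idP/imsetP => [/eqP /(prim_rootP zp)[i ->]|[i _ ->]].
      by exists i.
    by rewrite -exprM mulnC exprM (prim_expr_order zp) expr1n.
  rewrite card_imset ?card_ord // => i j /eqP; rewrite (eq_prim_root_expr zp) !modn_small //.
  by move/eqP/val_inj.
have co : coprime 3 q.-1 by rewrite prime_coprime.
have -> : [set x : F | x ^+ 3 == 1]%SET = [set 1]%SET; last by rewrite cards1.
apply/setP => x; rewrite !inE; apply/eqP/eqP => [x3|->]; last by rewrite expr1n.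
have x0 : x != 0 by apply/eqP => x0; move: x3; rewrite x0 expr0n /= => /eqP; rewrite eq_sym oner_eq0.
have xq := expf_card_pred x0.
(* By Bezout cubing is invertible on nonzero elements, so 1 is the only cube root of 1. *)
have [[u v] /= uv] : exists uv : nat * nat, (uv.1 * 3 = uv.2 * q.-1 + 1)%N.
  by case: (@egcdnP 3 q.-1 isT) => u v e _; exists (u, v); rewrite /= e (eqP co).
have : x ^+ (u * 3) = x ^+ (v * q.-1 + 1) by rewrite uv.
by rewrite mulnC exprM x3 expr1n exprD mulnC exprM xq expr1n mul1r expr1.
Qed.

End ProjectiveCount.

(** * The hypergeometric sum as a point count *)

Section HypergeometricCount.
Variables (R : realType) (F : finFieldType).
Local Notation C := (Cplx R).
Local Notation q := #|F|.
Variables omega Theta : F -> C.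
Hypothesis homega : generates_mult_characters omega.
Hypothesis hTheta : nontrivial_add_character Theta.
Variable c : F.
Hypothesis c0 : c != 0.

(** Uses q [A = 0] = 1 + sum_{w != 0} Theta(w A); the dual variable w becomes the fourth torus
    coordinate. *)
Lemma torus_count_exp_sum :
  q%:R * (torus_count c)%:R = (q.-1)%:R ^+ 3 +
  \sum_(p : F * F * F * F | (p.1.1.1 != 0) && (p.1.1.2 != 0) && (p.1.2 != 0) && (p.2 != 0))
     Theta (p.2 * affine_eq c p.1.1.1 p.1.1.2 p.1.2) :> C.
Proof.
transitivity (\sum_(x : F | x != 0) \sum_(y : F | y != 0) \sum_(z : F | z != 0)
    (1 + \sum_(w | w != 0) Theta (w * affine_eq c x y z))).
  rewrite /torus_count natr_sum mulr_sumr; apply: eq_bigr => x _.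
  rewrite natr_sum mulr_sumr; apply: eq_bigr => y _.
  rewrite natr_sum mulr_sumr; apply: eq_bigr => z _.
  by rewrite sum_add_char_mul // addrC subrK.
under eq_bigr do under eq_bigr do rewrite big_split /= sum_nonzero_const mulr1.
under eq_bigr do rewrite big_split /= sum_nonzero_const.
rewrite big_split /= sum_nonzero_const; congr (_ + _).
by rewrite !pair_big.
Qed.

Lemma curve_count_exp_sum :
  q%:R * (curve_count F)%:R = (q.-1)%:R ^+ 2 +
  \sum_(p : F * F * F | (p.1.1 != 0) && (p.1.2 != 0) && (p.2 != 0))
     Theta (p.2 * curve_eq p.1.1 p.1.2) :> C.
Proof.
transitivity (\sum_(y : F | y != 0) \sum_(z : F | z != 0)
    (1 + \sum_(w | w != 0) Theta (w * curve_eq y z))).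
  rewrite /curve_count natr_sum mulr_sumr; apply: eq_bigr => y _.
  rewrite natr_sum mulr_sumr; apply: eq_bigr => z _.
  by rewrite sum_add_char_mul // addrC subrK.
under eq_bigr do rewrite big_split /= sum_nonzero_const mulr1.
rewrite big_split /= sum_nonzero_const; congr (_ + _).
by rewrite !pair_big.
Qed.

(** Multiplying out w times [affine_eq] gives five monomials, which satisfy the relation v^27 = c^27
    z0^9 z1^6 z2^7 z3^5; conversely every solution of it arises from a unique torus point. *)
Lemma torus_reparam :
  \sum_(p | nz5 p && (monomial5 p * c ^- 27 == 1)) Theta (sum5 p) =
  \sum_(p : F * F * F * F | (p.1.1.1 != 0) && (p.1.1.2 != 0) && (p.1.2 != 0) && (p.2 != 0))
     Theta (p.2 * affine_eq c p.1.1.1 p.1.1.2 p.1.2).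
Proof.
pose h (p : F * F * F * F) : F * F * F * F * F :=
  let: (x, y, z, w) := p in
  (w * (c * (x * y * z)), w * (x ^+ 3 * y), w * (y ^+ 3 * z), w * z ^+ 3, w).
(* With V = x y z, Z0 = x^3 y, Z1 = y^3 z and Z2 = z^3, these are the monomials in V, Z0, Z1, Z2
   that evaluate to x, y and z. *)
pose h' (p : F * F * F * F * F) : F * F * F * F :=
  let: (v, z0, z1, z2, z3) := p in
  let V := v / (c * z3) in let Z0 := z0 / z3 in let Z1 := z1 / z3 in let Z2 := z2 / z3 in
  (V ^+ 4 / (Z0 * Z1 * Z2), Z0 ^+ 4 * Z1 ^+ 3 * Z2 ^+ 3 / V ^+ 12,
   V ^+ 9 / (Z0 ^+ 3 * Z1 ^+ 2 * Z2 ^+ 2), z3).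
rewrite (reindex_onto h h') /=; last first.
  move=> [[[[v z0] z1] z2] z3] /andP[/andP[/andP[/andP[/andP[/= v0 h0] h1] h2] /= h3]].
  rewrite /monomial5 /= => /eqP rel.
  rewrite /h /h'; congr (_, _, _, _, _).
  - by field; rewrite ?c0 ?v0 ?h0 ?h1 ?h2 ?h3.
  - by field; rewrite ?c0 ?v0 ?h0 ?h1 ?h2 ?h3.
  (* The coordinates [v] and [z0] are recovered identically, [z1] and [z2] only up to a factor that
     the relation sets to 1. *)
  - rewrite -[RHS]divr1 -rel.
    by field; rewrite ?c0 ?v0 ?h0 ?h1 ?h2 ?h3.
  - rewrite -[RHS]mulr1 -rel.
    by field; rewrite ?c0 ?v0 ?h0 ?h1 ?h2 ?h3.
apply: eq_big => [[[[x y] z] w]|[[[x y] z] w] _]; last first.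
  by rewrite /sum5 /h /affine_eq /=; congr Theta; ring.
rewrite /nz5 /h /monomial5 /=; apply/idP/idP.
  move=> /andP[/andP[/andP[/andP[/andP[/andP[h1 _] _] _] ->] _] _].
  by move: h1; rewrite !mulf_eq0 !negb_or => /andP[_ /andP[_ /andP[/andP[-> ->] ->]]].
move=> /andP[/andP[/andP[x0 y0] z0] w0].
rewrite !(mulf_neq0, expf_neq0) //= w0 /=; apply/andP; split.
  by apply/eqP; field; rewrite ?c0 ?x0 ?y0 ?z0 ?w0.
apply/eqP; congr (_, _, _, _).
- by field; rewrite ?c0 ?x0 ?y0 ?z0 ?w0.
- by field; rewrite ?c0 ?x0 ?y0 ?z0 ?w0.
- by field; rewrite ?c0 ?x0 ?y0 ?z0 ?w0.
Qed.

(* Extracting a ninth root from the relation decouples [x4] and [x0], which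
   leave a factor [(-1) * (-1)]. *)
Lemma curve_reparam :
  \sum_(t | t != 0) \sum_(p | nz5 p && (monomial5 p * (c ^- 27 * t ^+ 9) == 1)) Theta (sum5 p) =
  \sum_(p : F * F * F | (p.1.1 != 0) && (p.1.2 != 0) && (p.2 != 0))
     Theta (p.2 * curve_eq p.1.1 p.1.2).
Proof.
transitivity (\sum_(p : F * F * (F * F * F) | (p.1.1 != 0) && (p.1.2 != 0) &&
   ((p.2.1.1 != 0) && (p.2.1.2 != 0) && (p.2.2 != 0)))
   (Theta p.1.1 * Theta p.1.2) * Theta (p.2.2 * curve_eq p.2.1.1 p.2.1.2)); last first.
  rewrite -[RHS]mul1r -[1 in RHS]mulr1 -[1 * 1]mulrNN.
  by rewrite -(sum_nonzero_add_char hTheta) !mulr_sum_pair.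
rewrite pair_big_dep /=.
(* The relation reads (t v^3 / (c^3 z0))^9 = z1^6 z2^7 z3^5. At z1 = w y^3 z, z2 = w z^3, z3 = w its
   right side is the ninth power of w^2 y^2 z^3; equating the bases defines t. *)
pose h (p : F * F * (F * F * F)) : F * (F * F * F * F * F) :=
  let: ((v, z0), ((y, z), w)) := p in
  (y ^+ 2 * (w * z ^+ 3) * w * z0 * c ^+ 3 / v ^+ 3,
   (v, z0, w * (y ^+ 3 * z), w * z ^+ 3, w)).
(* [Y] recovers y^2 and [V] recovers y^9, so y = Y^5 / V. *)
pose h' (p : F * (F * F * F * F * F)) : F * F * (F * F * F) :=
  let: (t, (v, z0, z1, z2, z3)) := p in
  let Y := t * v ^+ 3 / (c ^+ 3 * z0) / (z2 * z3) in let V := z1 ^+ 3 / (z2 * z3 ^+ 2) in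
  ((v, z0), ((Y ^+ 5 / V, z1 / z3 / (Y ^+ 5 / V) ^+ 3), z3)).
rewrite (reindex_onto h h') /=; last first.
  move=> [t [[[[v z0] z1] z2] z3]] /= /andP[t0] /andP[/andP[/andP[/andP[/andP[/= v0 h0] h1] h2] /= h3]].
  rewrite /monomial5 /= => /eqP rel.
  rewrite /h /h'; congr (_, (_, _, _, _, _)).
  - rewrite -[RHS]divr1 -(expr1n F 4) -rel.
    by field; rewrite ?c0 ?v0 ?h0 ?h1 ?h2 ?h3 ?t0.
  - by field; rewrite ?c0 ?v0 ?h0 ?h1 ?h2 ?h3 ?t0.
  - rewrite -[RHS]divr1 -(expr1n F 5) -rel.
    by field; rewrite ?c0 ?v0 ?h0 ?h1 ?h2 ?h3 ?t0.
apply: eq_big => [[[v z0] [[y z] w]]|[[v z0] [[y z] w]] _]; last first.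
  rewrite /sum5 /h /curve_eq /= !add_charD // -!add_charD //.
  by congr Theta; ring.
rewrite /nz5 /h /monomial5 /=; apply/idP/idP.
  move=> /andP[/andP[_ /andP[/andP[/andP[/andP[/andP[-> ->] h3] _] ->] _]] _].
  move: h3; rewrite mulf_eq0 negb_or => /andP[_]; rewrite mulf_eq0 negb_or expf_eq0.
  by move=> /andP[-> ->].
move=> /andP[/andP[v0 h0] /andP[/andP[y0 z0'] w0]].
rewrite v0 h0 w0 !(mulf_neq0, invr_neq0, expf_neq0) //=; apply/andP; split.
  by apply/eqP; field; rewrite ?c0 ?v0 ?h0 ?y0 ?z0' ?w0.
apply/eqP; congr (_, (_, _)); congr (_, _).
- by field; rewrite ?c0 ?v0 ?h0 ?y0 ?z0' ?w0.
- by field; rewrite ?c0 ?v0 ?h0 ?y0 ?z0' ?w0.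
Qed.

Lemma torus_exp_sum :
  \sum_(p | nz5 p && (monomial5 p * c ^- 27 == 1)) Theta (sum5 p) =
  q%:R * (torus_count c)%:R - (q.-1)%:R ^+ 3.
Proof. by rewrite torus_count_exp_sum; apply: (etrans torus_reparam); rewrite addrC addKr. Qed.

Lemma curve_exp_sum :
  \sum_(t | t != 0) \sum_(p | nz5 p && (monomial5 p * (c ^- 27 * t ^+ 9) == 1)) Theta (sum5 p) =
  q%:R * (curve_count F)%:R - (q.-1)%:R ^+ 2.
Proof. by rewrite curve_count_exp_sum; apply: (etrans curve_reparam); rewrite addrC addKr. Qed.

(** The sign (-1)^5 turns the prefactor into 1 / (q - 1). The constants of the two exponential sums
    add up to (q - 1)^3 + (q - 1)^2 = q (q - 1)^2, which the factor 1/q reduces to (q - 1)^2. *)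
Lemma hypergeom_sumE (t : F) :
  - (ratr (hgm_M [:: 27]%N [:: 9; 6; 7; 5]%N))^-1 * t = c ^- 27 ->
  hypergeom_sum omega Theta hgm_alpha hgm_beta t =
  (torus_count c)%:R + (curve_count F)%:R - (q.-1)%:R ^+ 2.
Proof.
move=> ht; have [] := cyc_exponents_uniq (hgm_cyc_exponents R).
rewrite /hypergeom_sum; case: (exponents_of R hgm_alpha hgm_beta) => ps qs /= hps hqs.
have {hps} -> : ps = [:: 27]%N by apply/perm_small_eq.
have -> : sumn qs = 27%N by rewrite (perm_sumn hqs).
have -> : hgm_M [:: 27]%N qs = hgm_M [:: 27]%N [:: 9; 6; 7; 5]%N.
  by rewrite /hgm_M (perm_big _ hqs).
have -> : (-1) ^+ (size [:: 27%N] + size qs) = -1 :> C by rewrite (perm_size hqs) /= -signr_odd.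
have -> : (-1) ^+ 27 = -1 :> F by rewrite -signr_odd.
have ht' : -1 / ratr (hgm_M [:: 27]%N [:: 9; 6; 7; 5]%N) * t = c ^- 27 by rewrite mulN1r.
rewrite ht'.
have q1 : (0 < q.-1)%N by have := finNzRing_gt1 F; case: q => [|[]].
have qE : q = q.-1.+1 by rewrite prednK // card_field_gt0.
have q0 : q%:R != 0 :> C by rewrite pnatr_eq0 -lt0n card_field_gt0.
have q10 : (q.-1)%:R != 0 :> C by rewrite pnatr_eq0 -lt0n.
have qE' : q%:R = (q.-1)%:R + 1 :> C by rewrite [in LHS]qE -natr1.
have rm m : root_mult R [:: 27]%N qs q m = (q.-1 %| 9 * m)%N :> nat.
  by rewrite {1}qE hgm_root_mult.
have u0 t' : t' != 0 -> c ^- 27 * t' ^+ 9 != 0.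
  by move=> t0; rewrite mulf_neq0 ?invr_neq0 ?expf_neq0.
have term (m : nat) : (q%:R : C) ^ ((root_mult R [:: 27]%N qs q m)%:Z - (root_mult R [:: 27]%N qs q 0)%:Z) =
    q%:R^-1 * (1 + \sum_(t' | t' != 0) omega (t' ^+ 9) ^+ m).
  rewrite !rm muln0 dvdn0.
  rewrite (eq_bigr (fun t' => omega t' ^+ (9 * m))); last by move=> x x0; rewrite mult_charX // -exprM.
  rewrite sum_mult_char_powl //; case: (_ %| _)%N.
    by rewrite subrr expr0z mulr1 addrC -qE' mulVf.
  by rewrite sub0r mulr0 addr0 mulr1 exprN1.
rewrite big_mkord.
rewrite (eq_bigr (fun m : 'I_q.-1 => q%:R^-1 *
   ((\sum_(p | nz5 p) omega (monomial5 p) ^+ m * Theta (sum5 p)) * omega (c ^- 27) ^+ m +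
    \sum_(t' | t' != 0) (\sum_(p | nz5 p) omega (monomial5 p) ^+ m * Theta (sum5 p)) *
       omega (c ^- 27 * t' ^+ 9) ^+ m))); last first.
  move=> m _; rewrite term -(prod_gauss_sums homega hTheta) -mulr_sumr (perm_big _ hqs) /=.
  rewrite !big_cons !big_nil !mulr1.
  have -> : \sum_(t' | t' != 0) omega (c ^- 27 * t' ^+ 9) ^+ m =
     omega (c ^- 27) ^+ m * \sum_(t' | t' != 0) omega (t' ^+ 9) ^+ m.
    rewrite mulr_sumr; apply: eq_bigr => x x0.
    by rewrite mult_charM ?invr_neq0 ?expf_neq0 // exprMn.
  by ring.
rewrite -mulr_sumr big_split /= exchange_big /=.
rewrite sum_nz5_mult_char ?invr_neq0 ?expf_neq0 //.
have -> : \sum_(t' | t' != 0) \sum_(m < q.-1)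
    (\sum_(p | nz5 p) omega (monomial5 p) ^+ m * Theta (sum5 p)) * omega (c ^- 27 * t' ^+ 9) ^+ m =
    (q.-1)%:R * \sum_(t' | t' != 0)
      \sum_(p | nz5 p && (monomial5 p * (c ^- 27 * t' ^+ 9) == 1)) Theta (sum5 p).
  by rewrite mulr_sumr; apply: eq_bigr => t' t'0; rewrite sum_nz5_mult_char ?u0.
rewrite -mulrDr torus_exp_sum curve_exp_sum.
rewrite qE' in q0 *; field; rewrite q0 /=.
have -> : 1 - ((q.-1)%:R + 1) = - (q.-1)%:R :> C by ring.
by rewrite oppr_eq0.
Qed.

Lemma card_surface_points_hypergeom (psi t : F) :
  c = - (27%:R * psi) ->
  - (ratr (hgm_M [:: 27]%N [:: 9; 6; 7; 5]%N))^-1 * t = c ^- 27 ->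
  #|surface_points psi|%:R = 1 + q%:R + q%:R ^+ 2 + q%:R * (cube_roots F)%:R +
    hypergeom_sum omega Theta hgm_alpha hgm_beta t.
Proof.
move=> cE ht; rewrite hypergeom_sumE // card_surface_points -cE !natrD !natrM.
have -> : q%:R = (q.-1)%:R + 1 :> C by rewrite natr1 prednK // card_field_gt0.
by ring.
Qed.

End HypergeometricCount.

(** * Reduction of rationals *)

Section Reduction.
Variable F : fieldType.

(** [ratr] uses the reduced fraction; its denominator divides b by Gauss, so it stays invertible in
    F. *)
Lemma ratr_frac (a b : int) : b%:~R != 0 :> F -> ratr (a%:~R / b%:~R) = a%:~R / b%:~R :> F.
Proof.
move=> bF; have b0 : b != 0 by apply: contraNneq bF => ->.
set x : rat := _ / _; have bq : b%:~R != 0 :> rat by rewrite intr_eq0.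
have dq : (denq x)%:~R != 0 :> rat by rewrite intr_eq0 denq_neq0.
have cross : numq x * b = a * denq x.
  apply: (@intr_inj rat); rewrite !rmorphM /=; apply/eqP.
  by rewrite -eqr_div // divq_num_den.
have dF : (denq x)%:~R != 0 :> F.
  have : (denq x %| b)%Z.
    rewrite -(@Gauss_dvdzr _ (numq x)) ?cross ?dvdz_mull //.
    by rewrite coprimezE coprime_sym coprime_num_den.
  by case/dvdzP => k bE; apply: contraNneq bF => d0; rewrite bE rmorphM /= d0 mulr0.
by rewrite /ratr; apply/eqP; rewrite eqr_div // -!rmorphM /= cross.
Qed.

Variable p : nat.
Hypothesis pF : p \in [pchar F].

Lemma intr_eq0_pchar (z : int) : (z%:~R == 0 :> F) = (p %| `|z|)%N.
Proof.
case: z => n; first by rewrite -pmulrn (dvdn_pcharf pF).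
by rewrite NegzE mulrNz oppr_eq0 abszN -pmulrn (dvdn_pcharf pF).
Qed.

Lemma natr_eq0_pchar (n : nat) : (n%:R == 0 :> F) = (p %| n)%N.
Proof. by rewrite (dvdn_pcharf pF). Qed.

(** For psi = a/b, the equation numq(t) K a^27 = b^27 denq(t), with p prime to K and to both parts
    of t, shows that a and b vanish together in F; being coprime, neither does. The second claim is
    M^-1 t = (27 psi)^-27 up to sign. *)
Lemma good_reduction (psi : rat) : psi != 0 ->
  p \notin [:: 2; 3; 5; 7]%N -> ~~ (p %| `|numq (t_of psi)|)%N ->
  ~~ (p %| `|denq (t_of psi)|)%N ->
  let c : F := - (27%:R * ratr psi) in
  c != 0 /\ - (ratr (hgm_M [:: 27]%N [:: 9; 6; 7; 5]%N))^-1 * ratr (t_of psi) = c ^- 27.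
Proof.
move=> psi0 hp nt dt; have pp := pcharf_prime pF.
have nz r : prime r -> r \in [:: 2; 3; 5; 7]%N -> r%:R != 0 :> F.
  move=> pr rin; rewrite natr_eq0_pchar dvdn_prime2 //; apply: contraNneq hp => ->.
  exact: rin.
have [n2 n3 n5 n7] : [/\ 2%:R != 0 :> F, 3%:R != 0 :> F, 5%:R != 0 :> F & 7%:R != 0 :> F].
  by split; apply: nz.
set a := numq psi; set b := denq psi; set t := t_of psi in nt dt *.
have a0 : a != 0 by rewrite numq_eq0.
have psiE : psi = a%:~R / b%:~R by rewrite divq_num_den.
have coab : coprime `|a| `|b| := coprime_num_den psi.
have aq : a%:~R != 0 :> rat by rewrite intr_eq0.
have bq : b%:~R != 0 :> rat by rewrite intr_eq0 denq_neq0.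
clearbody a b.
pose K : int := 2 ^+ 6 * 3 ^+ 24 * 5 ^+ 5 * 7 ^+ 7.
have KE (L : fieldType) : K%:~R = 2%:R ^+ 6 * 3%:R ^+ 24 * 5%:R ^+ 5 * 7%:R ^+ 7 :> L.
  have gen (x y z w : int) : (x ^+ 6 * y ^+ 24 * z ^+ 5 * w ^+ 7)%:~R =
      x%:~R ^+ 6 * y%:~R ^+ 24 * z%:~R ^+ 5 * w%:~R ^+ 7 :> L by rewrite 3!rmorphM !rmorphXn.
  exact: gen.
clearbody K.
have [Ka KaE] : exists Ka : int, forall L : fieldType, Ka%:~R = K%:~R * a%:~R ^+ 27 :> L.
  by exists (K * a ^+ 27) => L; rewrite rmorphM rmorphXn.
have [b27 b27E] : exists b27 : int, forall L : fieldType, b27%:~R = b%:~R ^+ 27 :> L.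
  by exists (b ^+ 27) => L; rewrite rmorphXn.
have Kq : K%:~R != 0 :> rat by rewrite KE !mulf_neq0 ?expf_neq0 // pnatr_eq0.
have KF : K%:~R != 0 :> F by rewrite KE !mulf_neq0 ?expf_neq0.
have tE : t = b27%:~R / Ka%:~R.
  rewrite /t /t_of psiE KaE b27E KE expr_div_n.
  by field; rewrite aq bq ?pnatr_eq0.
clearbody t.
have Kaq : Ka%:~R != 0 :> rat by rewrite KaE; exact: mulf_neq0 Kq (expf_neq0 _ aq).
have cross : numq t * Ka = b27 * denq t.
  apply: (@intr_inj rat); rewrite [LHS]rmorphM [RHS]rmorphM /=; apply/eqP.
  by rewrite -eqr_div ?divq_num_den ?tE // intr_eq0 denq_neq0.
have crossF : (numq t)%:~R * (K%:~R * a%:~R ^+ 27) = b%:~R ^+ 27 * (denq t)%:~R :> F.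
  have := congr1 (fun z : int => z%:~R : F) cross.
  by rewrite [LHS]rmorphM [RHS]rmorphM /= KaE b27E.
have ntF : (numq t)%:~R != 0 :> F by rewrite intr_eq0_pchar.
have dtF : (denq t)%:~R != 0 :> F by rewrite intr_eq0_pchar.
have ab : (a%:~R == 0 :> F) = (b%:~R == 0 :> F).
  apply/eqP/eqP => h; move: crossF; rewrite h expr0n ?mulr0 ?mul0r => /eqP.
    by rewrite eq_sym mulf_eq0 (negbTE dtF) orbF expf_eq0 => /andP[_ /eqP].
  by rewrite mulf_eq0 (negbTE ntF) mulf_eq0 (negbTE KF) /= expf_eq0 => /andP[_ /eqP].
have aF : a%:~R != 0 :> F.
  apply/negP => h; have h' := h; rewrite ab in h'; move: h h'; rewrite !intr_eq0_pchar => h h'.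
  have /eqP g1 := coab.
  have : (p %| gcdn `|a| `|b|)%N by rewrite dvdn_gcd h h'.
  by rewrite g1 dvdn1 => /eqP p1; move: pp; rewrite p1.
have bF : b%:~R != 0 :> F by rewrite -ab.
have psiF : ratr psi = a%:~R / b%:~R :> F by rewrite {1}psiE ratr_frac.
have n27 (L : fieldType) : 27%:R = 3%:R ^+ 3 :> L by rewrite -natrX.
have n9 (L : fieldType) : 9%:R = 3%:R ^+ 2 :> L by rewrite -natrX.
have n6 (L : fieldType) : 6%:R = 2%:R * 3%:R :> L by rewrite -natrM.
pose A : int := 3 ^+ 57; pose B : int := 2 ^+ 6 * 5 ^+ 5 * 7 ^+ 7.
have BE (L : fieldType) : B%:~R = 2%:R ^+ 6 * 5%:R ^+ 5 * 7%:R ^+ 7 :> L.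
  have gen (x z w : int) : (x ^+ 6 * z ^+ 5 * w ^+ 7)%:~R =
      x%:~R ^+ 6 * z%:~R ^+ 5 * w%:~R ^+ 7 :> L by rewrite 2!rmorphM !rmorphXn.
  exact: gen.
have AE (L : fieldType) : A%:~R = 3%:R ^+ 57 :> L.
  have gen (x : int) : (x ^+ 57)%:~R = x%:~R ^+ 57 :> L by rewrite rmorphXn.
  exact: gen.
clearbody A B.
(* Lowest terms: 27^27 / (9^9 6^6 7^7 5^5) = 3^57 / (2^6 5^5 7^7). *)
have ME : hgm_M [:: 27]%N [:: 9; 6; 7; 5]%N = A%:~R / B%:~R.
  have gen (m x y z w : nat) : hgm_M [:: m] [:: x; y; z; w] =
      m%:R ^+ m / (x%:R ^+ x * (y%:R ^+ y * (z%:R ^+ z * w%:R ^+ w))).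
    by rewrite /hgm_M !big_cons !big_nil !mulr1.
  rewrite gen AE BE n27 n9 n6.
  have q2 : 2%:R != 0 :> rat by rewrite pnatr_eq0.
  have q3 : 3%:R != 0 :> rat by rewrite pnatr_eq0.
  have q5 : 5%:R != 0 :> rat by rewrite pnatr_eq0.
  have q7 : 7%:R != 0 :> rat by rewrite pnatr_eq0.
  move: (2%:R : rat) (3%:R : rat) (5%:R : rat) (7%:R : rat) q2 q3 q5 q7 => x2 x3 x5 x7 q2 q3 q5 q7.
  by field; rewrite ?q2 ?q3 ?q5 ?q7.
have BF : B%:~R != 0 :> F by rewrite BE !mulf_neq0 ?expf_neq0.
move=> c; split; first by rewrite oppr_eq0 psiF n27 (mulf_neq0 (expf_neq0 _ n3)) // mulf_neq0 ?invr_neq0.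
rewrite ME ratr_frac // tE ratr_frac; last by rewrite KaE; exact: mulf_neq0 KF (expf_neq0 _ aF).
rewrite /c psiF AE BE KaE b27E KE n27.
move: (2%:R : F) (3%:R : F) (5%:R : F) (7%:R : F) (a%:~R : F) (b%:~R : F) n2 n3 n5 n7 aF bF.
move=> x2 x3 x5 x7 y z h2 h3 h5 h7 hy hz.
rewrite exprNn -signr_odd /= expr1 mulN1r invrN mulNr; congr (- _).
by field; rewrite ?h2 ?h3 ?h5 ?h7 ?hy ?hz.
Qed.

End Reduction.

(** * Integers and primes of Q(sqrt(-3)) *)

(** The monic integer polynomial is transported to [algC], where a rational algebraic integer is an
    integer. *)
Lemma rat_integral_int (K : fieldExtType rat) (q : rat) :
  integralOver (intr : int -> K) (q%:A : K) -> exists z : int, q = z%:~R.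
Proof.
move=> [f fmon]; have -> : map_poly (intr : int -> K) f = map_poly (in_alg K) (map_poly intr f).
  by rewrite -map_poly_comp; apply: eq_map_poly => z /=; rewrite -[RHS]/(in_alg K z%:~R) rmorph_int.
rewrite -[q%:A]/(in_alg K q) fmorph_root => rq.
have ra : root (map_poly (intr : int -> algC) f) (ratr q).
  have -> : map_poly (intr : int -> algC) f = map_poly (ratr : rat -> algC) (map_poly intr f).
    by rewrite -map_poly_comp; apply: eq_map_poly => z /=; rewrite rmorph_int.
  by rewrite fmorph_root.
have : (ratr q : algC) \in Num.int.
  apply: Cint_rat_Aint; first exact: Crat_rat.
  apply: root_monic_Aint ra _ _; first exact: monic_map.
  by apply/polyOverP => i; rewrite coef_map /=; exact: intr_int.
case/intrP => z zE; exists z; apply: (fmorph_inj (ratr : {rmorphism rat -> algC})).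
by rewrite /= zE rmorph_int.
Qed.

Section Eisenstein.
Variables (K : fieldExtType rat) (theta : K).
Hypothesis htheta : theta ^+ 2 = - 3%:R.
Hypothesis hK : (<<1; theta>> = fullv)%VS.
Local Notation OK := (@ring_of_integers K).
Local Notation r := (in_alg K).

Lemma quad_repr (x : K) : exists a b : rat, x = r a + r b * theta.
Proof.
have pw n : exists a b : rat, theta ^+ n = r a + r b * theta.
  elim: n => [|n [a [b e]]]; first by exists 1, 0; rewrite expr0 rmorph1 rmorph0 mul0r addr0.
  exists (- 3%:R * b), a; rewrite exprSr e rmorphM rmorphN rmorph_nat.
  by rewrite mulrDl -mulrA -expr2 htheta; ring.
have : x \in <<1; theta>>%VS by rewrite hK memvf.
case/Fadjoin_polyP => f /polyOverP f1 ->; rewrite horner_coef.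
elim/big_ind: _ => [|x1 x2 [a [b ->]] [c [d ->]]|i _].
- by exists 0, 0; rewrite rmorph0 mul0r addr0.
- by exists (a + c), (b + d); rewrite !rmorphD; ring.
- have [a [b ->]] := pw i; have /vlineP[k ->] := f1 i.
  exists (k * a), (k * b); rewrite !rmorphM -[k *: 1]/(r k); ring.
Qed.

(** A relation with b nonzero would make theta rational, with negative square. *)
Lemma quad_indep (a b : rat) : r a + r b * theta = 0 -> a = 0 /\ b = 0.
Proof.
have [->|b0] := eqVneq b 0.
  by rewrite rmorph0 mul0r addr0 => /eqP; rewrite fmorph_eq0 => /eqP.
move=> h; have rb : r b != 0 by rewrite fmorph_eq0.
have te : theta = r (- a / b).
  apply: (mulfI rb); rewrite -rmorphM mulrCA divff // mulr1 rmorphN.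
  by apply/eqP; rewrite -addr_eq0 addrC h.
have : (- a / b) ^+ 2 = - 3%:R.
  have := congr1 (fun z => z ^+ 2) te; rewrite /= htheta -[_%:A]/(r _) -rmorphXn.
  by rewrite -(rmorph_nat r) -rmorphN => /fmorph_inj <-.
move=> e; have := sqr_ge0 (- a / b); rewrite e.
by rewrite oppr_ge0 leNgt ltr0n.
Qed.

Lemma quad_int_indep (m n m' n' : int) :
  m%:~R + n%:~R * theta = m'%:~R + n'%:~R * theta -> m = m' /\ n = n'.
Proof.
move=> h; have [] := @quad_indep (m - m')%:~R (n - n')%:~R.
  by rewrite !rmorph_int !rmorphB mulrBl /= addrACA h -opprD subrr.
by move=> /eqP; rewrite intr_eq0 subr_eq0 => /eqP -> /eqP; rewrite intr_eq0 subr_eq0 => /eqP.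
Qed.

(** Stands in for the conjugation theta -> -theta: an integer polynomial takes conjugate values at
    conjugate arguments, so integrality passes to the conjugate. *)
Lemma horner_conj (f : {poly int}) (a b : rat) : exists A B : rat,
  (map_poly intr f).[r a + r b * theta] = r A + r B * theta /\
  (map_poly intr f).[r a - r b * theta] = r A - r B * theta.
Proof.
elim/poly_ind: f => [|f c [A [B [h1 h2]]]].
  by exists 0, 0; rewrite rmorph0 !horner0 rmorph0 mul0r addr0 subr0.
exists (A * a - 3%:R * B * b + c%:~R), (A * b + B * a).
rewrite rmorphD rmorphM /= map_polyX map_polyC /= !hornerMXaddC h1 h2.
have rE (q : rat) : q%:A = r q by [].
rewrite !rE !(rmorphD, rmorphN, rmorphM, rmorph_nat, rmorph_int).
split; apply/eqP; rewrite -subr_eq0; apply/eqP.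
  transitivity (r B * r b * (theta ^+ 2 + 3%:R)); first by ring.
  by rewrite htheta addNr mulr0.
transitivity (r B * r b * (theta ^+ 2 + 3%:R)); first by ring.
by rewrite htheta addNr mulr0.
Qed.

Lemma OK_conj_rat (a b : rat) : OK (r a + r b * theta) -> OK (r a - r b * theta).
Proof.
move=> [f fmon /rootP h]; exists f => //; apply/rootP.
have [A [B [h1 ->]]] := horner_conj f a b; move: h; rewrite h1.
by move=> /quad_indep[-> ->]; rewrite rmorph0 mul0r subr0.
Qed.

Lemma OK_D x y : OK x -> OK y -> OK (x + y). Proof. exact: integral_add. Qed.
Lemma OK_B x y : OK x -> OK y -> OK (x - y). Proof. exact: integral_sub. Qed.
Lemma OK_M x y : OK x -> OK y -> OK (x * y). Proof. exact: integral_mul. Qed.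
Lemma OK_int (z : int) : OK z%:~R. Proof. exact: integral_id. Qed.

Lemma OK_theta : OK theta.
Proof.
exists ('X^2 + 3%:R%:P); first by rewrite monicE lead_coefDl ?lead_coefXn // size_polyXn size_polyC; case: eqP.
by rewrite rmorphD /= map_polyXn map_polyC /= rootE hornerD hornerXn hornerC htheta addNr.
Qed.

Lemma OK_quad (m n : int) : OK (m%:~R + n%:~R * theta).
Proof. by apply: OK_D (OK_int _) (OK_M (OK_int _) OK_theta). Qed.

(* [x'] is the conjugate of [x]. *)
Lemma OK_repr x : OK x -> exists m n k : int, exists x' : K, [/\ x * 2%:R = m%:~R + n%:~R * theta,
  OK x', x' * 2%:R = m%:~R - n%:~R * theta & x * x' = k%:~R].
Proof.
have [a [b xE]] := quad_repr x; rewrite {1}xE => ox; have ox' := OK_conj_rat ox.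
set x' := _ - _ in ox'; rewrite -xE in ox.
have [m mE] : exists m : int, 2%:R * a = m%:~R.
  apply: (@rat_integral_int K); rewrite -[_%:A]/(r _).
  have -> : r (2%:R * a) = x + x' by rewrite xE /x' rmorphM rmorph_nat; ring.
  exact: OK_D.
have [k kE] : exists k : int, a ^+ 2 + 3%:R * b ^+ 2 = k%:~R.
  apply: (@rat_integral_int K); rewrite -[_%:A]/(r _).
  have -> : r (a ^+ 2 + 3%:R * b ^+ 2) = x * x'.
    rewrite xE /x' rmorphD [X in _ + X = _]rmorphM rmorph_nat !rmorphXn.
    transitivity (r a ^+ 2 - r b ^+ 2 * theta ^+ 2); last by ring.
    by rewrite htheta; ring.
  exact: OK_M.
(* The norm alone does not bound the denominator of b. The integral element (x - x') theta equals
   -6b; its square is 3 (4k - m^2), so 3 divides it and 2b is an integer. *)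
have [w wE] : exists w : int, - (6%:R * b) = w%:~R.
  apply: (@rat_integral_int K); rewrite -[_%:A]/(r _).
  have -> : r (- (6%:R * b)) = (x - x') * theta.
    rewrite xE /x' rmorphN rmorphM rmorph_nat.
    transitivity (2%:R * r b * theta ^+ 2); last by ring.
    by rewrite htheta; ring.
  by apply: OK_M; [exact: OK_B|exact: OK_theta].
have w2 : w ^+ 2 = 3 * (4 * k - m ^+ 2).
  apply: (@intr_inj rat); transitivity ((w%:~R : rat) ^+ 2); first by rewrite rmorphXn.
  transitivity (3%:R * (4%:R * k%:~R - m%:~R ^+ 2) : rat); last first.
    by rewrite [RHS]rmorphM rmorphB rmorphM rmorphXn.
  by rewrite -mE -kE -wE; ring.
have [n wn] : exists n : int, w = - (3 * n).
  have d3 : (3 %| w ^+ 2)%Z by rewrite w2 dvdz_mulr.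
  have : (3 %| w)%Z.
    by move: d3; rewrite !dvdzE abszX Euclid_dvdX // => /andP[].
  by case/dvdzP => n ->; exists (- n); rewrite mulrN opprK mulrC.
have nE : 2%:R * b = n%:~R.
  have : - (6%:R * b) = - (3%:R * n%:~R) :> rat by rewrite wE wn rmorphN rmorphM.
  by lra.
exists m, n, k, x'; split=> //.
- rewrite xE -(rmorph_int r m) -(rmorph_int r n) -mE -nE !rmorphM rmorph_nat; ring.
- rewrite /x' -(rmorph_int r m) -(rmorph_int r n) -mE -nE !rmorphM rmorph_nat; ring.
- rewrite -(rmorph_int r k) -kE xE /x' rmorphD [X in _ = _ + X]rmorphM rmorph_nat !rmorphXn.
  transitivity (r a ^+ 2 - r b ^+ 2 * theta ^+ 2); first by ring.
  by rewrite htheta; ring.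
Qed.

End Eisenstein.

(** * Reduction of the integers of Q(sqrt(-3)) to finite fields of characteristic prime to 6 *)

Section ReductionMaps.
Variables (K : fieldExtType rat) (theta : K).
Hypothesis htheta : theta ^+ 2 = - 3%:R.
Hypothesis hK : (<<1; theta>> = fullv)%VS.
Local Notation OK := (@ring_of_integers K).
Variables (F : finFieldType) (p : nat).
Hypothesis pF : p \in [pchar F].
Hypothesis p2 : p != 2%N.
Hypothesis p3 : p != 3%N.

(** Coordinates are doubled because integers of the field only have their double in Z[theta]. The
    pair (0, 0) is the value elsewhere. *)
Definition half_coords (x : K) : int * int :=
  xget (0, 0) [set mn : int * int | x * 2%:R = mn.1%:~R + mn.2%:~R * theta]%classic.

(* [x = (m + n theta) / 2] goes to [(m + n a) / 2], where [a ^ 2 = -3] *)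
Definition redmap (a : F) (x : K) : F :=
  ((half_coords x).1%:~R + (half_coords x).2%:~R * a) / 2%:R.

Lemma natr2_neq0 : 2%:R != 0 :> F.
Proof.
have pp := pcharf_prime pF; rewrite (natr_eq0_pchar pF) dvdn_prime2 //.
Qed.

Lemma natr3_neq0 : 3%:R != 0 :> F.
Proof.
have pp := pcharf_prime pF; rewrite (natr_eq0_pchar pF) dvdn_prime2 //.
Qed.

Lemma natrK2_neq0 : 2%:R != 0 :> K.
Proof. by rewrite -(rmorph_nat (in_alg K)) fmorph_eq0 pnatr_eq0. Qed.

Lemma redmapE a x (m n : int) : x * 2%:R = m%:~R + n%:~R * theta ->
  redmap a x = (m%:~R + n%:~R * a) / 2%:R.
Proof.
move=> h; rewrite /redmap.
have := @xgetPex _ (0, 0) _ (ex_intro _ (m, n) h : exists mn, [set mn : int * int | x * 2%:R = mn.1%:~R + mn.2%:~R * theta]%classic mn).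
rewrite -/(half_coords x) /=; rewrite h => /(quad_int_indep htheta)[<- <-] //.
Qed.

Lemma redmap_quad a (m n : int) : redmap a (m%:~R + n%:~R * theta) = m%:~R + n%:~R * a.
Proof.
rewrite (@redmapE _ _ (2 * m) (2 * n)); last by rewrite !rmorphM /=; ring.
by rewrite !rmorphM /=; field; exact: natr2_neq0.
Qed.

Lemma redmap_int a (m : int) : redmap a m%:~R = m%:~R.
Proof. by have := redmap_quad a m 0; rewrite !mul0r !addr0. Qed.

Variable a : F.
Hypothesis ha : a ^+ 2 = - 3%:R.

Lemma redmapD x y : OK x -> OK y -> redmap a (x + y) = redmap a x + redmap a y.
Proof.
move=> /(OK_repr htheta hK)[m [n [_ [_ [h _ _ _]]]]] /(OK_repr htheta hK)[m' [n' [_ [_ [h' _ _ _]]]]].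
rewrite (redmapE a h) (redmapE a h') (@redmapE _ _ (m + m') (n + n')) ?rmorphD /=; first by field; exact: natr2_neq0.
by rewrite mulrDl h h'; ring.
Qed.

(** Coordinates of 4xy = (2x)(2y) are compared; the same relation, theta^2 = -3 and a^2 = -3,
    governs both products, and 2 is invertible in F. *)
Lemma redmapM x y : OK x -> OK y -> redmap a (x * y) = redmap a x * redmap a y.
Proof.
move=> ox oy; move: (ox) (oy).
move=> /(OK_repr htheta hK)[m [n [_ [_ [h _ _ _]]]]] /(OK_repr htheta hK)[m' [n' [_ [_ [h' _ _ _]]]]].
have /(OK_repr htheta hK)[M [N [_ [_ [H _ _ _]]]]] := OK_M ox oy.
have [e1 e2] : 2 * M = m * m' - 3 * (n * n') /\ 2 * N = m * n' + m' * n.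
  apply: (quad_int_indep htheta); rewrite !(rmorphD, rmorphN, rmorphM) /=.
  transitivity (2%:R * (M%:~R + N%:~R * theta)); first by ring.
  rewrite -H; transitivity ((x * 2%:R) * (y * 2%:R)); first by ring.
  rewrite h h'; transitivity (m%:~R * m'%:~R + n%:~R * n'%:~R * theta ^+ 2 + (m%:~R * n'%:~R + m'%:~R * n%:~R) * theta); first by ring.
  by rewrite htheta; ring.
rewrite (redmapE a h) (redmapE a h') (redmapE a H).
have n2 := natr2_neq0; apply: (mulfI (mulf_neq0 n2 n2)).
transitivity ((2 * M)%:~R + (2 * N)%:~R * a : F); first by rewrite !rmorphM /=; field; exact: n2.
rewrite e1 e2 !(rmorphD, rmorphN, rmorphM) /=.
transitivity ((m%:~R + n%:~R * a) * (m'%:~R + n'%:~R * a)); last by field; exact: n2.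
transitivity (m%:~R * m'%:~R + n%:~R * n'%:~R * a ^+ 2 + (m%:~R * n'%:~R + m'%:~R * n%:~R) * a); last by ring.
by rewrite ha; ring.
Qed.

Definition redker : set K := [set x | OK x /\ redmap a x = 0]%classic.

Lemma redker_prime : nonzero_prime_ideal redker /\ redker p%:R.
Proof.
have p0 : redker p%:R.
  split; first exact: OK_int p.
  by rewrite -[p%:R]/(p%:~R) redmap_int; apply/eqP; rewrite (intr_eq0_pchar pF).
split=> //; split.
- split; first by move=> x [].
  by split; [exact: (OK_int _ 0)|rewrite -[0]/(0%:~R) redmap_int].
- by move=> x y [ox hx] [oy hy]; split; [exact: OK_D|rewrite redmapD // hx hy addr0].
- by move=> x y ox [oy hy]; split; [exact: OK_M|rewrite redmapM // hy mulr0].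
- split; first by move=> [_]; rewrite -[1]/(1%:~R) redmap_int => /eqP; rewrite oner_eq0.
  move=> x y ox oy [_]; rewrite redmapM // => /eqP; rewrite mulf_eq0.
  by case/orP => /eqP h; [left|right].
- exists p%:R => //; rewrite -(rmorph_nat (in_alg K)) fmorph_eq0 pnatr_eq0.
  by have := prime_gt0 (pcharf_prime pF); case: (p).
Qed.

Definition redimage : set F := [set redmap a x | x in OK]%classic.

Lemma redimage_quad (m n : int) : redimage (m%:~R + n%:~R * a).
Proof. by exists (m%:~R + n%:~R * theta); [exact: OK_quad|exact: redmap_quad]. Qed.

(** The cosets of the kernel are the fibres of the reduction, indexed by F when it is onto. *)
Lemma ideal_norm_redker : (forall y, redimage y) -> ideal_norm redker = #|F|.
Proof.
move=> surj; pose J (y : F) : set K := [set x | OK x /\ redmap a x = y]%classic.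
have JE x : OK x -> [set x + y | y in redker]%classic = J (redmap a x).
  move=> ox; apply/seteqP; split=> [_ [y [oy hy] <-]|z [oz hz]].
    by split; [exact: OK_D|rewrite redmapD // hy addr0].
  exists (z - x); last by rewrite addrC subrK.
  split; first exact: OK_B.
  apply: (addIr (redmap a x)); rewrite add0r -redmapD ?subrK //; exact: OK_B.
have Jinj : injective J.
  move=> y y' e; have [x ox xy] := surj y.
  by have : J y x by []; rewrite e => -[_ <-].
rewrite /ideal_norm; have -> : residue_ring redker = [set` [fset J y | y in enum F]%fset]%classic.
  apply/seteqP; split=> [_ [x ox <-]|X /=].
    by rewrite JE //=; apply/imfsetP; exists (redmap a x); rewrite ?mem_enum.
  move/imfsetP => [y _ ->]; have [x ox <-] := surj y.
  by exists x; rewrite ?JE.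
rewrite set_fsetK card_imfset //= undup_id ?enum_uniq // -cardT //.
Qed.

End ReductionMaps.

(** * Classification of the primes above p *)

Section PrimesAbove.
Variables (K : fieldExtType rat) (theta : K).
Hypothesis htheta : theta ^+ 2 = - 3%:R.
Hypothesis hK : (<<1; theta>> = fullv)%VS.
Local Notation OK := (@ring_of_integers K).

Lemma prime_ideal_int (P : set K) (p : nat) (k : int) : nonzero_prime_ideal P ->
  prime p -> P p%:R -> P k%:~R -> (p %| `|k|)%N.
Proof.
move=> [[_ P0] PD PM [P1 _] _] pp Pp Pk; rewrite -[(p %| _)%N]negbK -prime_coprime //.
apply/negP => co; apply: P1.
have /coprimezP[[u v] /= uv] : coprimez p k by rewrite coprimezE.
have -> : 1 = u%:~R * p%:R + v%:~R * k%:~R :> K.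
  by rewrite -[p%:R]/(p%:~R) -!rmorphM -rmorphD /= uv.
by apply: PD; apply: PM => //; exact: OK_int.
Qed.

(** A nonzero x in P has a nonzero norm x x' in P; splitting off the least prime factor repeatedly
    ends at a rational prime in P, since P omits 1. *)
Lemma prime_ideal_above (P : set K) : nonzero_prime_ideal P -> exists2 p, prime p & P p%:R.
Proof.
move=> [[PO P0] PD PM [P1 Pp] [x Px x0]].
have [m [n [k [x' [h ox' h' xx']]]]] := OK_repr htheta hK (PO _ Px).
have kn0 : k%:~R != 0 :> K.
  rewrite -xx' mulf_neq0 //; apply/eqP => x'0; move: h'; rewrite x'0 mul0r => /eqP.
  rewrite eq_sym subr_eq add0r => /eqP e.
  have e0 : m%:~R + (- n)%:~R * theta = 0%:~R + 0%:~R * theta.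
    by rewrite rmorphN mulNr e subrr !mul0r addr0.
  have [m0 /eqP] := quad_int_indep htheta e0; rewrite oppr_eq0 => /eqP n0.
  move: h; rewrite m0 n0 !mul0r addr0 => /eqP.
  by rewrite mulf_eq0 (negbTE x0) (negbTE (natrK2_neq0 K)).
have Pk : P (`|k|%N)%:R.
  have : P k%:~R by rewrite -xx' mulrC; apply: PM.
  case: (intP k) kn0 => [|j|j] kn0; first by move: kn0; rewrite eqxx.
    by [].
  by rewrite rmorphN abszN => /(PM (-1) _ (OK_int K (-1))); rewrite mulrNN mul1r.
have k0 : (0 < `|k|)%N by rewrite absz_gt0; apply: contraNneq kn0 => ->.
elim/ltn_ind: (`|k|%N) k0 Pk => j IH j0 Pj.
have [j1|j1] := leqP j 1.
  by exfalso; apply: P1; have -> : 1 = j%:R :> K by rewrite (_ : j = 1%N) //; apply/eqP; rewrite eqn_leq j1.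
have jE : j = (pdiv j * (j %/ pdiv j))%N by rewrite mulnC divnK ?pdiv_dvd.
have q0 : (0 < j %/ pdiv j)%N by rewrite divn_gt0 ?pdiv_gt0 // pdiv_leq.
move: Pj; rewrite {1}jE natrM => Pj.
case: (Pp _ _ (OK_int K (pdiv j)) (OK_int K (j %/ pdiv j)%N) Pj) => h1.
  by exists (pdiv j) => //; exact: pdiv_prime.
apply: (IH (j %/ pdiv j)%N) => //.
by rewrite ltn_Pdiv // prime_gt1 // pdiv_prime.
Qed.

Variables (F : finFieldType) (p : nat).
Hypothesis pF : p \in [pchar F].
Hypothesis p2 : p != 2%N.
Hypothesis p3 : p != 3%N.
Variable a : F.
Hypothesis ha : a ^+ 2 = - 3%:R.

(* For [x] in [P] the norm [x * x'] vanishes mod [p], so [P] is contained in the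
   union of the two kernels, hence in one of them. *)
Lemma primes_above_redker (P : set K) : nonzero_prime_ideal P -> P p%:R ->
  P = redker theta a \/ P = redker theta (- a).
Proof.
move=> hP Pp; have pp := pcharf_prime pF.
have [[PO P0] PD PM [P1 Pm] _] := hP.
have n2 := natr2_neq0 pF p2.
have haN : (- a) ^+ 2 = - 3%:R by rewrite sqrrN.
have a0 : a != 0.
  apply/eqP => a0; move: ha; rewrite a0 expr0n /= => /eqP; rewrite eq_sym oppr_eq0.
  by rewrite (negbTE (natr3_neq0 pF p3)).
have int0 b (k : int) : redmap theta b k%:~R = 0 :> F -> P k%:~R.
  rewrite (redmap_int htheta pF p2) => /eqP; rewrite (intr_eq0_pchar pF) => pk.
  have /dvdzP[u ->] : (p %| k)%Z by [].
  by rewrite rmorphM /=; apply: PM => //; exact: OK_int.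
have P2 x : OK x -> P (x * 2%:R) -> P x.
  move=> ox /(Pm _ _ ox (OK_int K 2))[//|P2]; exfalso.
  have := prime_ideal_int hP pp Pp (P2 : P 2%:~R); rewrite dvdn_prime2 //.
  by rewrite (negbTE p2).
have inU x : P x -> redmap theta a x = 0 \/ redmap theta (- a) x = 0.
  move=> Px; have ox := PO _ Px.
  have [m [n [k [x' [h ox' h' xx']]]]] := OK_repr htheta hK ox.
  have Pk : P k%:~R by rewrite -xx' mulrC; apply: PM.
  have pk := prime_ideal_int hP pp Pp Pk.
  have : redmap theta a (x * x') = 0.
    by rewrite xx' (redmap_int htheta pF p2); apply/eqP; rewrite (intr_eq0_pchar pF).
  rewrite (redmapM htheta hK pF p2 ha ox ox') => /eqP; rewrite mulf_eq0 => /orP[/eqP|/eqP]; first by left.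
  have h'' : x' * 2%:R = m%:~R + (- n)%:~R * theta by rewrite h' rmorphN mulNr.
  rewrite (redmapE htheta a h'') => e; right.
  by rewrite (redmapE htheta (- a) h) -e rmorphN mulrN mulNr.
have sub : (P `<=` redker theta a \/ P `<=` redker theta (- a))%classic.
  have [h|] := pselect (forall x, P x -> redmap theta a x = 0).
    by left=> x Px; split; [exact: PO|exact: h].
  move=> /existsNP[x /not_implyP[Px nx]]; right=> y Py; split; first exact: PO.
  have [hy|//] := inU _ Py.
  have hx : redmap theta (- a) x = 0 by case: (inU _ Px).
  case: (inU _ (PD _ _ Px Py)); rewrite (redmapD htheta hK pF p2) ?hx ?hy ?add0r ?addr0 //; exact: PO.
(* Reverse inclusion: for x in the kernel, x x' lies in P. If x' rather than x is in P, then m + n b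
   and m - n b both vanish, so p divides m and n, and 2x, hence x, is in P. *)
have sup b : b = a \/ b = - a -> (P `<=` redker theta b -> redker theta b `<=` P)%classic.
  move=> hb Pb x [ox hx].
  have hb2 : b ^+ 2 = - 3%:R by case: hb => ->.
  have [m [n [k [x' [h ox' h' xx']]]]] := OK_repr htheta hK ox.
  have h'' : x' * 2%:R = m%:~R + (- n)%:~R * theta by rewrite h' rmorphN mulNr.
  have Pk : P k%:~R.
    by apply: (int0 b); rewrite -xx' (redmapM htheta hK pF p2 hb2) // hx mul0r.
  move: Pk; rewrite -xx' => /(Pm _ _ ox ox')[//|/Pb[_ hx']].
  apply: (P2 _ ox); rewrite h.
  move: hx hx'; rewrite (redmapE htheta b h) (redmapE htheta b h'') => /eqP.
  rewrite mulf_eq0 invr_eq0 (negbTE n2) orbF => /eqP e1 /eqP.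
  rewrite mulf_eq0 invr_eq0 (negbTE n2) orbF rmorphN /= mulNr => /eqP e2.
  have m0 : m%:~R == 0 :> F.
    apply/eqP/(mulfI n2); rewrite mulr0.
    have -> : 2%:R * m%:~R = (m%:~R + n%:~R * b) + (m%:~R - n%:~R * b) :> F by ring.
    by rewrite e1 e2 addr0.
  have b0 : b != 0 by case: hb => ->; rewrite ?oppr_eq0.
  have n0 : n%:~R == 0 :> F.
    by move: e1; rewrite (eqP m0) add0r => /eqP; rewrite mulf_eq0 (negbTE b0) orbF.
  apply: PD; first by apply: (int0 b); rewrite (redmap_int htheta pF p2); exact/eqP.
  rewrite mulrC; apply: PM; first exact: OK_theta.
  by apply: (int0 b); rewrite (redmap_int htheta pF p2); exact/eqP.
by case: sub => h; [left|right]; apply/seteqP; split=> //; apply: sup => //; [left|right].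
Qed.

End PrimesAbove.

(** * Convergence of Euler products *)

Section LocalSeries.
Variable R : realType.
Local Notation C := (Cplx R).

Lemma has_pchar0_cplx : [pchar C] =i pred0.
Proof. exact: pchar_num. Qed.

Lemma fps_logderiv_eq (l l' e : nat -> C) : l =1 l' -> fps_logderiv l e -> fps_logderiv l' e.
Proof. by move=> /funext ->. Qed.

(** The partial sums of the product satisfy S'_{n+1} = S_{n+1} - c T S_n. *)
Lemma series_fps_mul_linear (c T : C) (b : nat -> C) (h : C) :
  (series (fun n => b n * T ^+ n) n @[n --> \oo] --> h)%classic ->
  (series (fun n => fps_mul (fun k => (1 - c *: 'X)`_k) b n * T ^+ n) n @[n --> \oo]
     --> (1 - c * T) * h)%classic.
Proof.
move=> hb; set S := series _ in hb; set S' := series _.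
have S'E n : S' n.+1 = S n.+1 - c * T * S n.
  elim: n => [|n IH].
    rewrite /S' /S /series /= !big_nat1 big_geq // mulr0 subr0 expr0 !mulr1.
    by rewrite fps_mulE big_ord1 coefB coefZ coefX coef1 mulr0 subr0 mul1r.
  have SS k : S k.+1 = S k + b k * T ^+ k by rewrite /S seriesSr.
  rewrite /S' seriesSr -/S' IH !SS.
  rewrite fps_mulE !big_ord_recl big1 ?addr0 /=; last first.
    by move=> i _; rewrite coefB coefZ coefX coef1 /= mulr0 subr0 mul0r.
  rewrite !coefB !coefZ !coefX !coef1 /= mulr0 subr0 mul1r sub0r mulr1 subn0 /bump /= addn0 subSS subn0.
  by rewrite exprS; ring.
clearbody S S'; rewrite -(cvg_shiftS S').
under eq_fun do rewrite S'E.
rewrite mulrBl mul1r; apply: cvgB; first by rewrite (cvg_shiftS S).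
by apply: cvgM hb; exact: cvg_cst.
Qed.

Lemma normc_sub_nat_le (a b : nat) (M : R) : a%:R <= M -> b%:R <= M -> normc (a%:R - b%:R : C) <= M.
Proof.
move=> aM bM.
have -> : a%:R - b%:R = ((a%:R - b%:R : R)%:C)%C :> C by rewrite rmorphB !rmorph_nat.
rewrite /normc /= expr0n /= addr0 sqrtr_sqr ler_norml.
by have a0 := ler0n R a; have b0 := ler0n R b; apply/andP; split; lra.
Qed.

Lemma normc_lim_sub1 (u : nat -> C) (B : R) (l : C) :
  (forall n, normc (u n.+1 - 1) <= B) -> (u n @[n --> \oo] --> l)%classic -> normc (l - 1) <= B.
Proof.
move=> uB ul; apply/ler_addgt0Pr => e e0.
have eC : 0 < (e%:C)%C :> C by have := ltcR 0 e; rewrite e0.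
move/cvgrPdist_lt : ul => /(_ _ eC)[N _ hN].
have := hN N.+1 (leqnSn N); rewrite normcplxE => h.
have {}h : normc (l - u N.+1 : C) < e by rewrite -ltcR.
have -> : l - 1 = (l - u N.+1) + (u N.+1 - 1) by rewrite addrA subrK.
by rewrite (le_trans (normc_cplxD _ _)) // addrC lerD // ltW.
Qed.

(** For Re s > 8 the terms of a local series are at most r^n with r = 2 p^4 p^-8 = 2 p^-4. The local
    value is then within 2r = 4 p^-4 of 1, which is at most p^-2 because p >= 3, and the p^-2 are
    summable. *)
Lemma euler_converges_bound (S : pred nat) (P : nat -> nat -> C) (s : C) :
  (forall p, prime p -> ~~ S p -> [/\ (2 < p)%N, P p 0%N = 1 &
     forall n, normc (P p n) <= (2 * p%:R ^+ 4) ^+ n]) ->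
  8 < complex.Re s -> euler_converges S P s.
Proof.
move=> hP s8; pose T p := natpow p (- s).
pose M n : R := expR (- 2 * ln n%:R).
have Res : complex.Re (- s) = - complex.Re s by case: (s).
have main p : prime p -> ~~ S p ->
    cvgn (series (fun n => P p n * T p ^+ n)) /\ normc (local_value P s p - 1) <= M p.
  move=> pp Sp; have [p2 P0 Pn] := hP _ pp Sp.
  have p0 : 0 < p%:R :> R by rewrite ltr0n prime_gt0.
  set d : R := p%:R^-1 ^+ 4.
  have d0 : 0 <= d by rewrite exprn_ge0 // invr_ge0 ltW.
  have p3 : 3 <= p%:R :> R by rewrite ler_nat.
  have pV : p%:R^-1 <= 3^-1 :> R by rewrite lef_pV2 ?posrE //.
  have pV0 : 0 <= p%:R^-1 :> R by rewrite invr_ge0 ltW.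
  have MpE : M p = p%:R^-1 ^+ 2.
    rewrite -[p%:R^-1]lnK ?posrE ?invr_gt0 // -expRM_natl lnV ?posrE // /M.
    by rewrite mulrN mulNr.
  have dM : 4 * d <= M p.
    rewrite MpE /d (_ : 4 = 2 + 2)%N // exprD mulrA ler_piMl ?exprn_ge0 //.
    have : p%:R^-1 ^+ 2 <= 3^-1 ^+ 2 :> R by rewrite lerXn2r ?nnegrE.
    by lra.
  have M9 : M p <= 9^-1.
    rewrite MpE (_ : 9^-1 = 3^-1 ^+ 2); last by rewrite exprVn -natrX.
    by rewrite lerXn2r ?nnegrE.
  have Tn : normc (T p) <= d ^+ 2.
    rewrite /T normc_natpow Res /d -exprM -[p%:R^-1]lnK ?posrE ?invr_gt0 // -expRM_natl ler_expR lnV ?posrE //.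
    rewrite mulNr mulrN lerN2 ler_wpM2r //; last by apply: ltW.
    by apply: ln_ge0; lra.
  set r := 2 * d.
  have r0 : 0 <= r by rewrite mulr_ge0.
  have r2 : r <= 2^-1 by rewrite /r; lra.
  have un n : normc (P p n * T p ^+ n) <= r ^+ n.
    rewrite normc_cplxM normc_cplxX.
    have -> : r ^+ n = (2 * p%:R ^+ 4) ^+ n * (d ^+ 2) ^+ n.
      have dp : p%:R ^+ 4 * d = 1 by rewrite /d -exprMn divff ?gt_eqF // expr1n.
      by rewrite -exprMn; congr (_ ^+ n); rewrite /r -[RHS]mulrA expr2 [p%:R ^+ 4 * _]mulrA dp mul1r.
    apply: ler_pM; rewrite ?normc_cplx_ge0 ?exprn_ge0 ?normc_cplx_ge0 //.
    by apply: lerXn2r; rewrite ?nnegrE ?normc_cplx_ge0 ?exprn_ge0.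
  have cs : cvgn (series (fun n => P p n * T p ^+ n)).
    apply: (@cplx_series_cvg _ _ (fun n => r ^+ n)) => //.
    have -> : (fun n => r ^+ n) = geometric 1 r by apply/funext => n; rewrite /= mul1r.
    by apply: is_cvg_geometric_series; rewrite ger0_norm //; lra.
  split=> //; apply: (le_trans _ dM).
  apply: normc_lim_sub1 cs => n.
  have -> : series (fun n => P p n * T p ^+ n) n.+1 - 1 = \sum_(k < n) P p k.+1 * T p ^+ k.+1.
    by rewrite /series /= big_mkord big_ord_recl P0 expr0 mulr1 addrC addKr.
  rewrite (le_trans (normc_cplx_sum _ _ _)) //.
  rewrite (le_trans (y := \sum_(k < n) r ^+ k.+1)) //; first by apply: ler_sum => k _; exact: un.
  have : (1 - r) * \sum_(k < n) r ^+ k.+1 <= r.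
    have -> : \sum_(k < n) r ^+ k.+1 = r * \sum_(k < n) r ^+ k.
      by rewrite mulr_sumr; apply: eq_bigr => k _; rewrite exprS.
    rewrite mulrCA -[X in _ * X]opprK -mulNr opprB -subrX1 opprB ler_piMr // lerBlDr lerDl.
    exact: exprn_ge0.
  have s0 : 0 <= \sum_(k < n) r ^+ k.+1 by apply: sumr_ge0 => k _; exact: exprn_ge0.
  move=> h; have -> : 4 * d = 2 * r by rewrite /r; ring.
  by nra.
split=> [p pp Sp|]; first by have [] := main p pp Sp.
(* The inverse of the local value is put in the form (1 - a_p)^-1. *)
have := @prod_converges_euler R (fun p => prime p && ~~ S p) (fun p => 1 - local_value P s p) M.
under eq_fun do under eq_bigr do rewrite opprB addrC subrK.
apply=> [n|n /andP[pn Sn]|n /andP[pn Sn]|]; first exact: expR_ge0.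
- by rewrite -opprB normc_cplxN; have [] := main n pn Sn.
- rewrite -opprB normc_cplxN; have [_ h] := main n pn Sn; rewrite (le_trans h) //.
  have [n2 _ _] := hP _ pn Sn.
  have := @normc_natpow_le_half R n 2 (prime_gt1 pn).
  rewrite normc_natpow /= => /(_ _); rewrite -/(M n) /M; apply.
  by rewrite lerDl.
- by apply: cvgn_series_natpow; rewrite ltr1n.
Qed.

End LocalSeries.

(** * The Dedekind zeta function *)

Section FiniteFieldSqrt.
Variable F : finFieldType.
Variable p : nat.
Hypothesis pF : p \in [pchar F].

(** From z^2 + z + 1 = 0 it follows that 2z + 1 is a square root of -3. *)
Lemma exists_cube_root1 : (3 %| #|F|.-1)%N -> exists z : F, 3.-primitive_root z /\ z ^+ 2 = - 1 - z.
Proof.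
move=> h3; have [g gp] := finField_prim_root F; have zp := dvdn_prim_root gp h3.
exists (g ^+ (#|F|.-1 %/ 3)); split=> //; set z := g ^+ _ in zp *.
have z1 : z - 1 != 0.
  rewrite subr_eq0; apply/eqP => z1; have := prim_order_dvd zp 1.
  by rewrite expr1 z1 eqxx.
apply: (mulfI z1); apply/eqP; rewrite -subr_eq0; apply/eqP.
transitivity (z ^+ 3 - 1); first by ring.
by rewrite (prim_expr_order zp) subrr.
Qed.

Lemma natr_ord_inj : injective (fun i : 'I_p => i%:R : F).
Proof.
have w (i j : 'I_p) : (i <= j)%N -> i%:R = j%:R :> F -> i = j.
  move=> ij /eqP; rewrite eq_sym -subr_eq0 -natrB // (natr_eq0_pchar pF) => d.
  apply/val_inj/eqP; rewrite eqn_leq ij /= leqNgt; apply/negP => lt.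
  by have := dvdn_leq _ d; rewrite subn_gt0 lt => /(_ isT); rewrite leqNgt (leq_ltn_trans (leq_subr _ _)).
move=> i j e; case/orP: (leq_total i j) => h; first exact: w.
by apply/esym/w.
Qed.

Lemma natr_ord_surj (y : F) : #|F| = p -> exists i : 'I_p, y = i%:R.
Proof.
move=> cF; have /codomP[i ->] := @inj_card_onto _ _ _ natr_ord_inj (eq_leq (etrans cF (esym (card_ord p)))) y.
by exists i.
Qed.

(** Frobenius turns u + v a = 0 into u - v a = 0. So 1 and a are independent over the prime field,
    and in a field of p^2 elements they form a basis. *)
Lemma frob_indep (a : F) (u v : int) : a != 0 -> 2%:R != 0 :> F -> a ^+ p = - a ->
  u%:~R + v%:~R * a = 0 -> u%:~R = 0 :> F /\ v%:~R = 0 :> F.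
Proof.
move=> a0 n2 ap e; have := congr1 (pFrobenius_aut pF) e.
rewrite rmorph0 rmorphD rmorphM !rmorph_int /= pFrobenius_autE ap mulrN => e'.
have u0 : u%:~R = 0 :> F.
  apply: (mulfI n2); rewrite mulr0.
  have -> : 2%:R * u%:~R = (u%:~R + v%:~R * a) + (u%:~R - v%:~R * a) :> F by ring.
  by rewrite e e' addr0.
by split=> //; move/eqP: e; rewrite u0 add0r mulf_eq0 (negbTE a0) orbF => /eqP.
Qed.

Lemma quad_surj (a : F) (y : F) : a != 0 -> 2%:R != 0 :> F -> a ^+ p = - a ->
  #|F| = (p ^ 2)%N -> exists i j : 'I_p, y = i%:R + j%:R * a.
Proof.
move=> a0 n2 ap cF; pose f (ij : 'I_p * 'I_p) : F := ij.1%:R + ij.2%:R * a.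
have finj : injective f.
  move=> [i j] [i' j'] /= e.
  have [] := @frob_indep a (i%:Z - i'%:Z) (j%:Z - j'%:Z) a0 n2 ap.
    rewrite !rmorphB mulrBl /= addrACA -opprD; apply/eqP; rewrite subr_eq0; exact/eqP.
  rewrite !rmorphB => /eqP; rewrite subr_eq0 => /eqP /natr_ord_inj -> /eqP.
  by rewrite subr_eq0 => /eqP /natr_ord_inj ->.
have cle : (#|F| <= #|{: 'I_p * 'I_p}|)%N by rewrite card_prod card_ord cF -mulnn.
by have /codomP[[i j] ->] := inj_card_onto finj cle y; exists i, j.
Qed.

End FiniteFieldSqrt.

(** * Primes grouped by the rational prime below *)

Section DedekindPartial.
Variables (fld : nat -> nat -> finFieldType).
Hypothesis hfld : forall p m, prime p -> (0 < m)%N -> #|fld p m| = (p ^ m)%N.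
Variables (K : fieldExtType rat) (theta : K).
Hypothesis htheta : theta ^+ 2 = - 3%:R.
Hypothesis hK : (<<1; theta>> = fullv)%VS.

Lemma fld_pchar p m : prime p -> (0 < m)%N -> p \in [pchar fld p m].
Proof. by move=> pp m0; exact: card_finPcharP (hfld pp m0) pp. Qed.

Lemma prime_mod3 p : prime p -> p != 3%N -> (p %% 3 == 1)%N || (p %% 3 == 2)%N.
Proof.
move=> pp p3; have : (p %% 3 < 3)%N by rewrite ltn_mod.
have : (p %% 3 != 0)%N by rewrite -[_ == _]/(3 %| p)%N dvdn_prime2 // eq_sym.
by case: (p %% 3)%N => [|[|[|]]].
Qed.

(** The common norm of the primes above p, in the split case as well as in the inert one. *)
Definition inert_norm p := (if p %% 3 == 1 then p else p ^ 2)%N.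

(** A square root a of -3 exists in F_p if p = 1 mod 3, and in F_{p^2} otherwise. The kernels
    attached to a and -a are distinct in the first case, and equal in the second because Frobenius
    exchanges a and -a. *)
Lemma primes_over p : prime p -> p != 2%N -> p != 3%N -> exists s : seq (set K),
  [/\ uniq s, (forall P, P \in s <-> nonzero_prime_ideal P /\ P p%:R),
      (forall P, P \in s -> ideal_norm P = inert_norm p)
    & size s = (if p %% 3 == 1 then 2 else 1)%N].
Proof.
move=> pp p2 p3; rewrite /inert_norm; case: ifPn => pm.
  have cF : #|fld p 1| = p by rewrite hfld // expn1.
  set F := fld p 1 in cF *; have pF : p \in [pchar F] by exact: fld_pchar.
  have n2 := natr2_neq0 pF p2.
  have [|z [_ z2]] := @exists_cube_root1 F.
    by rewrite cF -subn1 -eqn_mod_dvd ?prime_gt0.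
  pose a := 2%:R * z + 1.
  have ha : a ^+ 2 = - 3%:R.
    transitivity (4%:R * z ^+ 2 + 4%:R * z + 1); first by rewrite /a; ring.
    by rewrite z2; ring.
  have haN : (- a) ^+ 2 = - 3%:R by rewrite sqrrN.
  have surj (b y : F) : redimage theta b y.
    have [i ->] := natr_ord_surj pF y cF.
    by have := @redimage_quad K theta htheta F p pF p2 b i 0; rewrite mul0r addr0.
  have a0 : a != 0.
    apply/eqP => a0; move: ha; rewrite a0 expr0n /= => /eqP; rewrite eq_sym oppr_eq0.
    by rewrite (negbTE (natr3_neq0 pF p3)).
  (* For an integer k reducing to a, theta - k lies in the first kernel, while the other reduction
     sends it to -2a. *)
  have neq : redker theta a != redker theta (- a).
    apply/eqP => e; have [k ak] := natr_ord_surj pF a cF.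
    have akz : (k%:Z)%:~R = a :> F by rewrite [RHS]ak.
    have : redker theta a ((- k%:Z)%:~R + 1%:~R * theta).
      split; first exact: OK_quad.
      by rewrite (redmap_quad htheta pF p2) rmorphN mul1r /= akz addNr.
    rewrite e => -[_]; rewrite (redmap_quad htheta pF p2) rmorphN mul1r /= akz => /eqP.
    by rewrite -opprD oppr_eq0 -mulr2n -mulr_natl mulf_eq0 (negbTE n2) (negbTE a0).
  exists [:: redker theta a; redker theta (- a)]; split=> //=.
  - by rewrite inE neq.
  - move=> P; split; last first.
      case=> hP Pp; rewrite !inE.
      by case: (primes_above_redker htheta hK pF p2 p3 ha hP Pp) => ->; rewrite eqxx ?orbT.
    rewrite !inE => /orP[] /eqP ->; exact: (redker_prime htheta hK pF p2).
  - by move=> P; rewrite !inE => /orP[] /eqP ->; rewrite (ideal_norm_redker htheta hK pF p2) ?cF.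
have cF : #|fld p 2| = (p ^ 2)%N by rewrite hfld.
set F := fld p 2 in cF *; have pF : p \in [pchar F] by exact: fld_pchar.
have n2 := natr2_neq0 pF p2.
have pm2 : (p %% 3 = 2)%N by have := prime_mod3 pp p3; rewrite (negbTE pm) => /eqP.
have [|z [zp z2]] := @exists_cube_root1 F.
  by rewrite cF -subn1 -eqn_mod_dvd ?expn_gt0 ?prime_gt0 // -modnXm pm2.
pose a := 2%:R * z + 1.
have ha : a ^+ 2 = - 3%:R.
  transitivity (4%:R * z ^+ 2 + 4%:R * z + 1); first by rewrite /a; ring.
  by rewrite z2; ring.
have a0 : a != 0.
  apply/eqP => a0; move: ha; rewrite a0 expr0n /= => /eqP; rewrite eq_sym oppr_eq0.
  by rewrite (negbTE (natr3_neq0 pF p3)).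
(* As p = 2 mod 3, z^p = z^2 = -1 - z. *)
have ap : a ^+ p = - a.
  rewrite -(pFrobenius_autE pF) /a rmorphD rmorphM rmorph1 rmorph_nat /= pFrobenius_autE.
  by rewrite -(prim_expr_mod zp) pm2 z2; ring.
have surj (y : F) : redimage theta a y.
  have [i [j ->]] := quad_surj pF y a0 n2 ap cF.
  exact: (@redimage_quad K theta htheta F p pF p2 a i j).
have eqker : redker theta a = redker theta (- a).
  have apN : (- a) ^+ p = - - a.
    have op : odd p by case: (even_prime pp) p2 => // ->.
    by rewrite exprNn -signr_odd op expr1 mulN1r ap.
  have aN0 : - a != 0 by rewrite oppr_eq0.
  have half (b : F) x : b != 0 -> b ^+ p = - b -> redker theta b x -> redker theta (- b) x.
    move=> b0 bp [ox hx]; split=> //.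
    have [m [n [k [x' [h _ _ _]]]]] := OK_repr htheta hK ox.
    move: hx; rewrite (redmapE htheta b h) (redmapE htheta (- b) h) => /eqP.
    rewrite mulf_eq0 invr_eq0 (negbTE n2) orbF => /eqP /(frob_indep pF b0 n2 bp)[-> ->].
    by rewrite mul0r addr0 mul0r.
  apply/seteqP; split=> x hx; first exact: half.
  by rewrite -[a]opprK; exact: half.
exists [:: redker theta a]; split=> //=.
- move=> P; split; last first.
    case=> hP Pp; rewrite mem_seq1.
    by case: (primes_above_redker htheta hK pF p2 p3 ha hP Pp) => ->; rewrite -?eqker eqxx.
  rewrite mem_seq1 => /eqP ->; exact: (redker_prime htheta hK pF p2).
- by move=> P; rewrite mem_seq1 => /eqP ->; rewrite (ideal_norm_redker htheta hK pF p2).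
Qed.

Lemma uniq_flatten_map (I T : eqType) (l : seq I) (s : I -> seq T) : uniq l ->
  (forall i, i \in l -> uniq (s i)) ->
  (forall i j x, i \in l -> j \in l -> x \in s i -> x \in s j -> i = j) ->
  uniq (flatten [seq s i | i <- l]).
Proof.
elim: l => //= i l IH /andP[il ul] us dis; rewrite cat_uniq us ?mem_head //=.
rewrite IH //; last first.
- by move=> j k x jl kl; apply: dis; rewrite inE ?jl ?kl orbT.
- by move=> j jl; apply: us; rewrite inE jl orbT.
rewrite andbT; apply/hasPn => x /flatten_mapP[j jl xj]; apply/negP => xi.
by move: il; rewrite (dis i j x) ?mem_head ?inE ?jl ?orbT.
Qed.

Variables (R : realType) (S : pred nat).
Hypothesis S2 : S 2.
Hypothesis S3 : S 3.

(** Every prime of norm at most N lies above a single p, and p <= [inert_norm p] <= N, so the range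
    p <= N suffices. With 2 and 3 in S, [primes_over] covers all p that occur. *)
Lemma dedekind_partialE (w : Cplx R) (N : nat) : dedekind_partial K S w N =
  \prod_(p < N.+1 | [&& prime p && ~~ S p & (inert_norm p <= N)%N])
    ((1 - natpow (inert_norm p) (- w))^-1) ^+ (if p %% 3 == 1 then 2 else 1)%N.
Proof.
have ex p : exists s : seq (set K), prime p -> ~~ S p ->
  [/\ uniq s, (forall P, P \in s <-> nonzero_prime_ideal P /\ P p%:R),
      (forall P, P \in s -> ideal_norm P = inert_norm p)
    & size s = (if p %% 3 == 1 then 2 else 1)%N].
  case: (boolP (prime p)) => pp; last by exists [::].
  case: (boolP (S p)) => Sp; first by exists [::].
  have [||s hs] := @primes_over p pp; last by exists s.
    by apply: contraNneq Sp => ->.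
  by apply: contraNneq Sp => ->.
have [sq hsq] := choice ex.
pose l := [seq p <- index_iota 0 N.+1 | [&& prime p && ~~ S p & (inert_norm p <= N)%N]].
have lP p : p \in l -> prime p /\ ~~ S p /\ (inert_norm p <= N)%N.
  by rewrite mem_filter => /andP[/andP[/andP[pp Sp] ip] _].
have normle p : prime p -> (p <= inert_norm p)%N.
  by move=> pp; rewrite /inert_norm; case: ifP => // _; rewrite -mulnn leq_pmulr ?prime_gt0.
have setE : primes_upto S N = [set` flatten [seq sq p | p <- l]]%classic.
  apply/seteqP; split=> P /=.
    move=> [hP nS nN]; have [p pp Pp] := prime_ideal_above htheta hK hP.
    have Sp : ~~ S p by apply/negP => Sp; apply: nS; exists p.
    have [_ h1 h2 _] := hsq p pp Sp; have Ps := (h1 P).2 (conj hP Pp).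
    apply/flatten_mapP; exists p => //; rewrite mem_filter pp Sp -(h2 _ Ps) nN /= mem_index_iota /=.
    by rewrite ltnS (leq_trans (normle p pp)) // -(h2 _ Ps).
  move=> /flatten_mapP[p /lP[pp [Sp ip]] Ps]; have [_ h1 h2 _] := hsq p pp Sp.
  have [hP Pp] := (h1 P).1 Ps; split=> //; last by rewrite (h2 _ Ps).
  move=> [q [qp Sq Pq]]; have := prime_ideal_int hP pp Pp (Pq : P q%:~R).
  by rewrite dvdn_prime2 // => /eqP pq; move: Sp; rewrite pq Sq.
rewrite /dedekind_partial setE -fsbig_seq; last first.
  apply: uniq_flatten_map; first by rewrite filter_uniq // iota_uniq.
    by move=> p /lP[pp [Sp _]]; have [] := hsq p pp Sp.
  move=> p q P /lP[pp [Sp _]] /lP[qp [Sq _]] /= Pp Pq.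
  have [_ h1 _ _] := hsq p pp Sp; have [_ h1' _ _] := hsq q qp Sq.
  have [hP Pp'] := (h1 P).1 Pp; have [_ Pq'] := (h1' P).1 Pq.
  have := prime_ideal_int hP pp Pp' (Pq' : P q%:~R).
  by rewrite dvdn_prime2 // => /eqP.
rewrite big_flatten big_map big_filter big_mkord; apply: eq_bigr => p /andP[/andP[pp Sp] _].
have [_ _ h2 <-] := hsq p pp Sp.
rewrite (eq_big_seq (fun=> (1 - natpow (inert_norm p) (- w))^-1)); last by move=> P /h2 ->.
by rewrite big_const_seq count_predT iter_mulr_1.
Qed.

End DedekindPartial.

(** * Euler factors *)

Section ProductLimits.
Variable R : realType.
Local Notation C := (Cplx R).

Lemma cvg_mul_cplx (u v : nat -> C) (a b : C) :
  (u n @[n --> \oo] --> a)%classic -> (v n @[n --> \oo] --> b)%classic ->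
  (u n * v n @[n --> \oo] --> a * b)%classic.
Proof. by move=> ua vb; apply: cvgM ua vb. Qed.

Lemma cvg_limn_cplx (u : nat -> C) (a : C) : (u n @[n --> \oo] --> a)%classic -> limn u = a.
Proof. by move=> ua; apply: cvg_lim => //; exact: norm_hausdorff. Qed.

Lemma cvg_comp_sqrt (u : nat -> C) (a : C) : (u n @[n --> \oo] --> a)%classic ->
  (u (Nat.sqrt n) @[n --> \oo] --> a)%classic.
Proof.
move=> /cvgrPdist_lt h; apply/cvgrPdist_lt => e e0; have [N _ hN] := h e e0.
exists (N * N)%N => // n /= hn; apply: hN => /=.
apply/ssrnat.leP; rewrite -(PeanoNat.Nat.sqrt_square N).
by apply: PeanoNat.Nat.sqrt_le_mono; apply/ssrnat.leP.
Qed.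

Lemma sqrt_ltn p N : (p < (Nat.sqrt N).+1)%N = (p ^ 2 <= N)%N.
Proof.
have {}h1 : (Nat.sqrt N * Nat.sqrt N <= N)%N by apply/ssrnat.leP; exact: (PeanoNat.Nat.sqrt_spec' N).1.
have {}h2 : (N < (Nat.sqrt N).+1 * (Nat.sqrt N).+1)%N by apply/ssrnat.ltP; exact: (PeanoNat.Nat.sqrt_spec' N).2.
rewrite ltnS -mulnn; apply/idP/idP => h; first by rewrite (leq_trans _ h1) // leq_mul.
rewrite leqNgt; apply/negP => h'; have := leq_mul h' h'.
by move=> h3; have := leq_trans h2 h3; rewrite ltnNge h.
Qed.

End ProductLimits.

Section LocalFactors.
Variables (R : realType) (fld : nat -> nat -> finFieldType).
Hypothesis hfld : forall p m, prime p -> (0 < m)%N -> #|fld p m| = (p ^ m)%N.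
Local Notation C := (Cplx R).
Variables (psi : rat).

(** The character (-3/p), for primes p other than 3. *)
Definition quad_char (p : nat) : C := if (p %% 3 == 1)%N then 1 else -1.

Lemma expn2_mod3 n : (2 ^ n %% 3 = if odd n then 2 else 1)%N.
Proof.
elim: n => // n IH; rewrite expnS -modnMmr IH /=.
by case: (odd n).
Qed.

Lemma cube_roots_fld p n : prime p -> p != 3%N -> (0 < n)%N ->
  (cube_roots (fld p n))%:R = 2%:R + quad_char p ^+ n :> C.
Proof.
move=> pp p3 n0; have [g gp] := finField_prim_root (fld p n).
rewrite (cube_rootsE gp) hfld // -subn1 -eqn_mod_dvd ?expn_gt0 ?prime_gt0 // -modnXm /quad_char.
have := prime_mod3 pp p3; case: eqP => [->|_] /=.
  by move=> _; rewrite exp1n eqxx expr1n natr1.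
move=> /eqP ->; rewrite expn2_mod3 -signr_odd; case: (odd n) => /=; last by rewrite natr1.
by rewrite expr1 -[2%:R](natrD _ 1 1) addrK.
Qed.

(** Logarithmic derivative of P_p = 1 / ((1 - T)(1 - pT)(1 - p^2 T) Z_p): the linear factors account
    for 1 + q + q^2 and Z_p for the point count, where q = p^n. *)
Definition surface_log p (n : nat) : C := if n == 0%N then 0 else
  1 + (p ^ n)%:R + (p ^ n)%:R ^+ 2 - #|surface_points (ratr psi : fld p n)|%:R.

Lemma surface_logderiv p : fps_logderiv (surface_log p) (surface_Pp R fld psi p).
Proof.
have ch := has_pchar0_cplx R.
rewrite /surface_Pp; set D : {poly C} := _ * _ * _.
have hD := fps_logderiv_polyM (fps_logderiv_polyM
  (fps_logderiv_linear (1 : C)) (fps_logderiv_linear (p%:R : C))) (fps_logderiv_linear ((p ^ 2)%:R : C)).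
rewrite scale1r in hD; rewrite -/D in hD.
have hZ : fps_logderiv (fun n => if n == 0%N then 0 else #|surface_points (ratr psi : fld p n)|%:R)
    (surface_zeta R fld psi p).
  apply: fps_logderiv_eq (fps_logderiv_exp ch (erefl 0)) => n; rewrite /fps_euler.
  by case: n => [|n] /=; rewrite ?mul0r // mulrC divfK // pnatr_eq0.
apply: fps_logderiv_eq (fps_logderivV (fps_logderivM hD hZ)) => n /=.
rewrite /surface_log; case: n => [|n] /=; first by rewrite !addr0 oppr0.
by rewrite expr1n !natrX -!exprM mulnC; ring.
Qed.

(** Points are bounded by vectors; this exponent 4 is the one in the bound (2 p^4)^n on the Euler
    factors. *)
Lemma card_surface_points_le (F : finFieldType) (x : F) : (#|surface_points x| <= #|F| ^ 4)%N.
Proof.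
rewrite (leq_trans (leq_imset_card _ _)) // (leq_trans (max_card _)) //.
by rewrite card_mx mul1n.
Qed.

Variables omega Theta : forall p m, fld p m -> C.
Hypothesis homega : forall p m, prime p -> odd p -> (0 < m)%N ->
  generates_mult_characters (@omega p m).
Hypothesis hTheta : forall p m, prime p -> odd p -> (0 < m)%N ->
  nontrivial_add_character (@Theta p m).
Hypothesis psi0 : psi != 0.
Let t := t_of psi.

Definition hgm_log p (n : nat) : C := if n == 0%N then 0 else
  - hypergeom_sum (@omega p n) (@Theta p n) hgm_alpha hgm_beta (ratr t).

Lemma hgm_logderiv p : fps_logderiv (hgm_log p) (hgm_Lp omega Theta hgm_alpha hgm_beta t p).
Proof.
apply: fps_logderiv_eq (fps_logderiv_exp (has_pchar0_cplx R) (erefl 0)) => n; rewrite /fps_euler /hgm_log.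
by case: n => [|n] /=; rewrite ?mul0r // mulrN mulrC divfK // pnatr_eq0.
Qed.

Lemma good_prime p : prime p -> ~~ bad_prime t p ->
  [/\ (7 < p)%N, odd p, p \notin [:: 2; 3; 5; 7]%N, ~~ (p %| `|numq t|)%N & ~~ (p %| `|denq t|)%N].
Proof.
move=> pp; rewrite /bad_prime pp andTb; clear psi0; clearbody t.
rewrite !negb_or => /and5P[h1 h2 h3 _ _].
have p7 : (7 < p)%N by clear h2 h3; do 8 (case: p pp h1 => [|p] pp h1 //).
have op : odd p by case: (even_prime pp) p7 => // ->.
exact: And5 p7 op h1 h2 h3.
Qed.

Lemma card_surface_points_good p n : prime p -> ~~ bad_prime t p -> (0 < n)%N ->
  #|surface_points (ratr psi : fld p n)|%:R =
  1 + (p ^ n)%:R + (p ^ n)%:R ^+ 2 + (p ^ n)%:R * (cube_roots (fld p n))%:R +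
  hypergeom_sum (@omega p n) (@Theta p n) hgm_alpha hgm_beta (ratr t).
Proof.
move=> pp bp n0; have [_ op hp nt dt] := good_prime pp bp.
have [c0 ht] := good_reduction (fld_pchar hfld pp n0) psi0 hp nt dt.
have := card_surface_points_hypergeom (homega pp op n0) (hTheta pp op n0) c0 (erefl _) ht.
by rewrite hfld.
Qed.

(** By the point count the left side is - q (2 + chi(p)^n) - H_q with q = p^n; the first term splits
    into the logarithmic derivatives of 1 - pT, twice, and of 1 - chi(p) p T. *)
Lemma surface_log_hgm p n : prime p -> ~~ bad_prime t p ->
  surface_log p n = (if n == 0%N then 0 else - p%:R ^+ n) + ((if n == 0%N then 0 else - p%:R ^+ n) +
    ((if n == 0%N then 0 else - (quad_char p * p%:R) ^+ n) + hgm_log p n)).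
Proof.
move=> pp bp; rewrite /surface_log /hgm_log; case: n => [|n] /=; first by rewrite !addr0.
rewrite card_surface_points_good // cube_roots_fld //; last first.
  by have [h _ _ _ _] := good_prime pp bp; apply: contraTneq h => ->.
by rewrite natrX exprMn; ring.
Qed.

Definition linear_coef (c : C) (k : nat) : C := (1 - c *: 'X)`_k.

Lemma surface_Pp_hgm p : prime p -> ~~ bad_prime t p ->
  surface_Pp R fld psi p =1 fps_mul (linear_coef p%:R) (fps_mul (linear_coef p%:R)
    (fps_mul (linear_coef (quad_char p * p%:R)) (hgm_Lp omega Theta hgm_alpha hgm_beta t p))).
Proof.
move=> pp bp; apply: (fps_logderiv_uniq (has_pchar0_cplx R) _ (@surface_logderiv p)); first by [].
apply: fps_logderiv_eq (fun n => esym (@surface_log_hgm p n pp bp)) _.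
by do 3 (apply: fps_logderivM; first exact: fps_logderiv_linear); exact: hgm_logderiv.
Qed.

Lemma local_value_hgm p s : prime p -> ~~ bad_prime t p ->
  cvgn (series (fun n => hgm_Lp omega Theta hgm_alpha hgm_beta t p n * natpow p (- s) ^+ n)) ->
  local_value (surface_Pp R fld psi) s p =
  (1 - natpow p (- (s - 1))) ^+ 2 * (1 - quad_char p * natpow p (- (s - 1))) *
    local_value (hgm_Lp omega Theta hgm_alpha hgm_beta t) s p.
Proof.
move=> pp bp cH; have pT : natpow p (- (s - 1)) = p%:R * natpow p (- s).
  by rewrite opprB natpowD natpow1 // prime_gt0.
apply: cvg_limn_cplx.
rewrite (funext (surface_Pp_hgm pp bp)).
have h := series_fps_mul_linear (c := p%:R) (series_fps_mul_linear (c := p%:R)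
  (series_fps_mul_linear (c := quad_char p * p%:R) cH)).
have -> : (1 - natpow p (- (s - 1))) ^+ 2 * (1 - quad_char p * natpow p (- (s - 1))) *
    local_value (hgm_Lp omega Theta hgm_alpha hgm_beta t) s p =
  (1 - p%:R * natpow p (- s)) * ((1 - p%:R * natpow p (- s)) *
   ((1 - quad_char p * p%:R * natpow p (- s)) *
    local_value (hgm_Lp omega Theta hgm_alpha hgm_beta t) s p)) by rewrite pT; ring.
exact: h.
Qed.

(** For q = p^n > 7, both 1 + q + q^2 + 3q and the point count are at most q^4. The hypergeometric
    sum is bounded as the difference of two such integers, through the point count identity. *)
Lemma local_bounds p : prime p -> ~~ bad_prime t p ->
  [/\ (2 < p)%N, surface_Pp R fld psi p 0%N = 1, hgm_Lp omega Theta hgm_alpha hgm_beta t p 0%N = 1,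
   (forall n, normc (surface_Pp R fld psi p n) <= (2 * p%:R ^+ 4) ^+ n) &
   (forall n, normc (hgm_Lp omega Theta hgm_alpha hgm_beta t p n) <= (2 * p%:R ^+ 4) ^+ n)].
Proof.
move=> pp bp; have [p7 _ _ _ _] := good_prime pp bp.
have p3 : p != 3%N by apply: contraTneq p7 => ->.
have c0 : 0 <= p%:R ^+ 4 :> R by rewrite exprn_ge0.
have surf n : (0 < n)%N -> (#|surface_points (ratr psi : fld p n)|%:R : R) <= (p%:R ^+ 4) ^+ n.
  move=> n0; rewrite -natrX -natrX ler_nat (leq_trans (card_surface_points_le _)) //.
  by rewrite hfld // -!expnM mulnC.
have q7 n : (0 < n)%N -> (7 < p ^ n)%N.
  by move=> n0; rewrite (leq_trans p7) // -{1}(expn1 p) leq_exp2l // prime_gt1.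
have qb n : (0 < n)%N -> ((1 + p ^ n + (p ^ n) ^ 2 + p ^ n * 3)%N%:R : R) <= (p%:R ^+ 4) ^+ n.
  move=> n0; rewrite -natrX -natrX ler_nat.
  have -> : ((p ^ 4) ^ n = (p ^ n) ^ 4)%N by rewrite -!expnM mulnC.
  have := q7 n n0; move: (p ^ n)%N => q q8; rewrite !expnS expn0 muln1.
  have h1 : (8 * q <= q * q)%N by rewrite leq_mul2r q8 orbT.
  have h2 : (8 * (q * q) <= q * (q * q))%N by rewrite leq_mul2r q8 orbT.
  have h3 : (8 * (q * (q * q)) <= q * (q * (q * q)))%N by rewrite leq_mul2r q8 orbT.
  by lia.
split.
- by rewrite (leq_trans _ p7).
- by have [] := surface_logderiv p.
- by have [] := hgm_logderiv p.
- apply: (fps_logderiv_bound c0 _ _ (surface_logderiv p)) => // n n0.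
  rewrite /surface_log eqn0Ngt n0 /=.
  rewrite -(natrX _ (p ^ n)%N 2) -[1]/(1%:R) -!natrD; apply: normc_sub_nat_le; last exact: surf.
  by rewrite (le_trans _ (qb n n0)) // ler_nat leq_addr.
- apply: (fps_logderiv_bound c0 _ _ (hgm_logderiv p)) => // n n0.
  have -> : hgm_log p n = (1 + p ^ n + (p ^ n) ^ 2 + p ^ n * cube_roots (fld p n))%N%:R -
      #|surface_points (ratr psi : fld p n)|%:R.
    rewrite /hgm_log eqn0Ngt n0 /= card_surface_points_good // !natrD natrM !natrX.
    by ring.
  apply: normc_sub_nat_le; last exact: surf.
  rewrite (le_trans _ (qb n n0)) // ler_nat leq_add2l leq_mul2l.
  have [g gp] := finField_prim_root (fld p n).
  by rewrite (cube_rootsE gp); case: ifP; rewrite orbT.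
Qed.

End LocalFactors.

(** * Conclusion *)

Section DedekindLimit.
Variables (R : realType) (fld : nat -> nat -> finFieldType).
Hypothesis hfld : forall p m, prime p -> (0 < m)%N -> #|fld p m| = (p ^ m)%N.
Variables (K : fieldExtType rat) (theta : K).
Hypothesis htheta : theta ^+ 2 = - 3%:R.
Hypothesis hK : (<<1; theta>> = fullv)%VS.
Variable S : pred nat.
Hypothesis S2 : S 2.
Hypothesis S3 : S 3.
Variable w : Cplx R.
Hypothesis w1 : 1 < complex.Re w.
Local Notation C := (Cplx R).
Local Notation x p := (natpow p (- w)).

Definition split_partial (N : nat) : C :=
  \prod_(p < N.+1 | (prime p && ~~ S p) && (p %% 3 == 1)%N) (1 - x p)^-1.

Definition inert_partial (N : nat) : C :=
  \prod_(p < N.+1 | (prime p && ~~ S p) && (p %% 3 != 1)%N) (1 - natpow p (- (w + w)))^-1.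

Lemma split_partial_converges : prod_converges split_partial.
Proof.
apply: (@prod_converges_natpow R (fun p => (prime p && ~~ S p) && (p %% 3 == 1)%N)) => //.
by move=> p /andP[/andP[pp _] _]; exact: prime_gt1.
Qed.

Lemma inert_partial_converges : prod_converges inert_partial.
Proof.
apply: (@prod_converges_natpow R (fun p => (prime p && ~~ S p) && (p %% 3 != 1)%N)).
  by move=> p /andP[/andP[pp _] _]; exact: prime_gt1.
have -> : complex.Re (w + w) = complex.Re w + complex.Re w by case: (w).
by move: w1; lra.
Qed.

Lemma natpow_sqr p : natpow p (- (w + w)) = x p ^+ 2 :> C.
Proof. by rewrite opprD natpowD expr2. Qed.

(** Norm at most N means p <= N for split p and p^2 <= N for inert p; split primes come in pairs,
    whence the square. *)
Lemma dedekind_partial_sqrt N :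
  dedekind_partial K S w N = split_partial N ^+ 2 * inert_partial (Nat.sqrt N).
Proof.
rewrite (dedekind_partialE hfld htheta hK) // (bigID (fun p : 'I_N.+1 => (p %% 3 == 1)%N)) /=.
congr (_ * _).
  rewrite /split_partial -prodrXl; apply: eq_big => [p|p /andP[_ p3]]; last by rewrite /inert_norm p3.
  rewrite /inert_norm; case: (_ == 1)%N; rewrite ?andbF // !andbT.
  by rewrite -ltnS ltn_ord andbT.
have sN : ((Nat.sqrt N).+1 <= N.+1)%N.
  by rewrite ltnS; apply/ssrnat.leP/PeanoNat.Nat.sqrt_le_lin.
rewrite /inert_partial.
rewrite (@big_ord_widen_cond _ _ _ _ _ (fun p => (prime p && ~~ S p) && (p %% 3 != 1)%N)
  (fun p => (1 - natpow p (- (w + w)))^-1) sN).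
apply: eq_big => [p|p /andP[/andP[/andP[pp _] _] /negbTE p3]].
  rewrite sqrt_ltn /inert_norm; case: (_ == 1)%N; rewrite ?andbF // !andbT //.
rewrite /inert_norm p3 expr1 natpow_sqr natpowX //; exact: prime_gt0.
Qed.

Lemma dedekind_cvg : (dedekind_partial K S w n @[n --> \oo] -->
  limn split_partial ^+ 2 * limn inert_partial)%classic.
Proof.
have [cs _] := split_partial_converges; have [ci _] := inert_partial_converges.
under eq_fun do rewrite dedekind_partial_sqrt expr2.
by rewrite expr2; exact: cvg_mul_cplx (cvg_mul_cplx cs cs) (cvg_comp_sqrt ci).
Qed.

Lemma dedekind_converges : prod_converges (dedekind_partial K S w).
Proof.
have [cs ns] := split_partial_converges; have [ci ni] := inert_partial_converges.
have h := dedekind_cvg; split; first by apply/cvg_ex; eexists; exact: h.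
by rewrite (cvg_limn_cplx h) mulf_neq0 // expf_neq0.
Qed.

(** The same Euler factors cut at p <= N. Only the length of the inert product differs from
    [dedekind_partial], so the limits agree. *)
Lemma local_dedekind_partial N :
  \prod_(p < N.+1 | prime p && ~~ S p) ((1 - x p) * (1 - quad_char R p * x p))^-1 =
  split_partial N ^+ 2 * inert_partial N.
Proof.
rewrite (bigID (fun p : 'I_N.+1 => (p %% 3 == 1)%N)) /=; congr (_ * _).
  rewrite /split_partial -prodrXl; apply: eq_bigr => p /andP[_ p3].
  by rewrite /quad_char p3 mul1r invfM expr2.
rewrite /inert_partial; apply: eq_bigr => p /andP[_ /negbTE p3].
by rewrite /quad_char p3 natpow_sqr; congr (_^-1); ring.
Qed.

End DedekindLimit.

Lemma bad_prime_small (t : rat) p : prime p -> p \in [:: 2; 3; 5; 7]%N -> bad_prime t p.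
Proof. by rewrite /bad_prime => -> ->. Qed.

Section EulerProductComparison.
Variables (R : realType) (fld : nat -> nat -> finFieldType).
Hypothesis hfld : forall p m, prime p -> (0 < m)%N -> #|fld p m| = (p ^ m)%N.
Variables (K : fieldExtType rat) (theta : K).
Hypothesis htheta : theta ^+ 2 = - 3%:R.
Hypothesis hK : (<<1; theta>> = fullv)%VS.
Variable S : pred nat.
Hypothesis S2 : S 2.
Hypothesis S3 : S 3.
Variables LX LH : nat -> nat -> Cplx R.
Hypothesis lb : forall p, prime p -> ~~ S p -> [/\ (2 < p)%N, LX p 0%N = 1, LH p 0%N = 1,
  (forall n, normc (LX p n) <= (2 * p%:R ^+ 4) ^+ n) &
  (forall n, normc (LH p n) <= (2 * p%:R ^+ 4) ^+ n)].
Hypothesis lv : forall p s, prime p -> ~~ S p ->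
  cvgn (series (fun n => LH p n * natpow p (- s) ^+ n)) ->
  local_value LX s p = (1 - natpow p (- (s - 1))) ^+ 2 *
    (1 - quad_char R p * natpow p (- (s - 1))) * local_value LH s p.

(** With x = p^(1 - s), the factor (1 - x)^2 (1 - chi x) is regrouped as (1 - x)(1 - chi x), for the
    primes above p, times 1 - x, for the zeta function. The partial products factor accordingly and
    each factor has a limit. *)
Lemma euler_product_comparison :
  (exists sigma : R, forall s : Cplx R, sigma < complex.Re s ->
     [/\ euler_converges S LX s,
         prod_converges (dedekind_partial K S (s - 1)),
         prod_converges (zeta_partial S (s - 1))
       & euler_converges S LH s])
  /\
  (forall s : Cplx R, 2 < complex.Re s -> euler_converges S LH s ->
     euler_product S LX s =
       dedekind_zeta K S (s - 1) * zeta S (s - 1) * euler_product S LH s).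
Proof.
have Sx (s : Cplx R) : complex.Re (s - 1) = complex.Re s - 1 by case: (s).
have zeta_cvg (s : Cplx R) : 1 < complex.Re s -> prod_converges (zeta_partial S s).
  move=> s1; apply: (@prod_converges_natpow R (fun p => prime p && ~~ S p)) s1.
  by move=> p /andP[pp _]; exact: prime_gt1.
split.
  (* The half plane of [euler_converges_bound], on which Re (s - 1) > 1 holds too. *)
  exists 8 => s s8; have s1 : 1 < complex.Re (s - 1) by rewrite Sx; move: s8; lra.
  split; [|exact: (dedekind_converges hfld htheta hK)|exact: zeta_cvg|].
  - by apply: euler_converges_bound s8 => p pp Sp; have [h1 h2 _ h3 _] := lb pp Sp.
  - by apply: euler_converges_bound s8 => p pp Sp; have [h1 _ h2 _ h3] := lb pp Sp.
move=> s s2 [cH [pH _]].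
have w1 : 1 < complex.Re (s - 1) by rewrite Sx; move: s2; lra.
have [pZ _] := zeta_cvg _ w1.
have [ps _] := split_partial_converges S w1; have [pi _] := inert_partial_converges S w1.
have XE N : euler_partial S LX s N = split_partial S (s - 1) N ^+ 2 * inert_partial S (s - 1) N *
    zeta_partial S (s - 1) N * euler_partial S LH s N.
  rewrite -local_dedekind_partial /zeta_partial /euler_partial -!big_split /=.
  apply: eq_bigr => p /andP[pp Sp].
  by rewrite (lv pp Sp (cH p pp Sp)) !invfM; ring.
rewrite /euler_product (_ : limn (euler_partial S LX s) =
  limn (split_partial S (s - 1)) ^+ 2 * limn (inert_partial S (s - 1)) *
  limn (zeta_partial S (s - 1)) * limn (euler_partial S LH s)).
  by rewrite /dedekind_zeta (cvg_limn_cplx (dedekind_cvg hfld htheta hK S2 S3 w1)).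
apply: cvg_limn_cplx; under eq_fun do rewrite XE expr2.
by rewrite expr2; exact: cvg_mul_cplx (cvg_mul_cplx (cvg_mul_cplx (cvg_mul_cplx ps ps) pi) pZ) pH.
Qed.

End EulerProductComparison.

Theorem theorem6p3 (R : realType)
    (fld : nat -> nat -> finFieldType)
    (hfld : forall p m, prime p -> (0 < m)%N -> #|fld p m| = (p ^ m)%N)
    (omega Theta : forall p m, fld p m -> Cplx R)
    (homega : forall p m, prime p -> odd p -> (0 < m)%N ->
       generates_mult_characters (@omega p m))
    (hTheta : forall p m, prime p -> odd p -> (0 < m)%N ->
       nontrivial_add_character (@Theta p m))
    (K : fieldExtType rat) (theta : K)
    (htheta : theta ^+ 2 = - 3%:R) (hK : (<<1; theta>> = fullv)%VS)
    (psi : rat) (hpsi0 : psi != 0) (hpsi1 : psi != 1) :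
  let t := t_of psi in
  let S := bad_prime t in
  let LX := surface_Pp R fld psi in
  let LH := hgm_Lp omega Theta hgm_alpha hgm_beta t in
  (exists sigma : R, forall s : Cplx R, sigma < complex.Re s ->
     [/\ euler_converges S LX s,
         prod_converges (dedekind_partial K S (s - 1)),
         prod_converges (zeta_partial S (s - 1))
       & euler_converges S LH s])
  /\
  (forall s : Cplx R, 2 < complex.Re s ->
     euler_converges S LX s -> euler_converges S LH s ->
     euler_product S LX s =
       dedekind_zeta K S (s - 1) * zeta S (s - 1) * euler_product S LH s).
Proof.
move=> t S LX LH.
have [h1 h2] := euler_product_comparison hfld htheta hK
  (bad_prime_small t (isT : prime 2) isT) (bad_prime_small t (isT : prime 3) isT)
  (local_bounds hfld homega hTheta hpsi0) (local_value_hgm hfld homega hTheta hpsi0).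
by split=> [|s s2 _]; [exact: h1|exact: h2].
Qed.
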